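(* Let $\beta_b>1$, $\beta_g>0$, $d>4\beta_b$. The constants $\kappa>0$ and $v_0>0$ can be chosen (not depending on $n$ or $\theta$) so that, whenever $(t_n)$ is a deterministic sequence of positive numbers with $t_n\to0$ and $nt_n^d\to\infty$, there are constants $c,C>0$ such that, for all sufficiently large $n$ and uniformly over $\theta\in\Theta(\beta_b,\beta_g,d)$, $$\mathbb P_\theta\bigl\{|\mathcal C_n(t_n)|<c\,nt_n^d\bigr\}\le C\exp(-c\,nt_n^d).$$
   Context: **Hölder balls.** Fix an open set $U\subset\mathbb R^d$ containing $[0,1]^d$. For $s>0$ put $\ell_s=\lceil s\rceil-1$, $\alpha_s=s-\ell_s\in(0,1]$, and $\|g\|_{C^s(U)}=\sum_{|\nu|\le\ell_s}\|\partial^\nu g\|_{L^\infty(U)}+\max_{|\nu|=\ell_s}\sup_{x\ne y\in U}\frac{|\partial^\nu g(x)-\partial^\nu g(y)|}{\|x-y\|^{\alpha_s}}$. Let $\mathcal H^s(L;U)=\{g:U\to\mathbb R:\|g\|_{C^s(U)}\le L\}$. **Model.** Fix $0<\underline p<1<\overline p<\infty$, $L\ge1$, $0<\underline v\le\overline v<\infty$, $M_4>\overline v^{2}$. A parameter is $\theta=(p,f,\sigma^2,Q)$ with $p$ a density on $[0,1]^d$, $f$ a regression function, $\sigma^2>0$, $Q=(Q_x)_{x\in[0,1]^d}$ a Markov kernel. $\Theta(\beta_b,\beta_g,d)$ is the set of $\theta$ with: (i) $p$ is the restriction to $[0,1]^d$ of a function in $\mathcal H^{\beta_g}(L;U)$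 and $\underline p\le p\le\overline p$ on $[0,1]^d$; (ii) $f$ is the restriction to $[0,1]^d$ of a function in $\mathcal H^{\beta_b}(L;U)$; (iii) for $p(x)dx$-a.e. $x$, $\int u\,Q_x(du)=0$, $\int u^2Q_x(du)=\sigma^2$, $\int u^4Q_x(du)\le M_4$, with $\underline v\le\sigma^2\le\overline v$. One observes $n$ i.i.d. copies $(X_i,Y_i)$ with $X_i\sim p$, $Y_i=f(X_i)+\varepsilon_i$, $\varepsilon_i\mid X_i=x\sim Q_x$. Constants may depend on the model-class constants, $d,\beta_b,\beta_g,\lambda_0$, and the polynomial basis, but not on $n$ or $\theta$. **Partition.** Fix $\lambda_0>0$; $r_n=\max\{0,\operatorname{round}(\log_2(n/\lambda_0))\}$, $J_n=2^{r_n}$, $H_n=J_n^{-1/d}$. Choose nonnegative integers $s_{n,1},\dots,s_{n,d}$ with sum $r_n$, pairwise differing by at most one; split coordinate $j$ of $[0,1]^d$ into $2^{s_{n,j}}$ equal intervals. The resulting partition $\mathcal Q_n$ has $J_n$ axis-aligned rectangular cells of volume $J_n^{-1}$ (boundaries assigned by a fixed half-open convention). Write $\overline Q=b_Q+A_Q[0,1]^d$ with $A_Q$ diagonal, and for $X_i\in Q$ let $U_i=A_Q^{-1}(X_i-b_Q)\in[0,1]^d$. **Cell quantities.** $\ell=\lceil\beta_b\rceil-1$, $q=\binom{d+\ell}{\ell}$; $\psi=(\psi_1,\dots,\psi_q)^\top$ is a fixed basis of polynomials on $\mathbb R^d$ of total degree at most $\ell$. For a cell $Q$: $I_Q=\{i:X_i\in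 Q\}=\{i_1<\dots<i_{N_Q}\}$, $\Phi_Q\in\mathbb R^{N_Q\times q}$ has rows $\psi(U_{i_r})^\top$, $G_Q=\Phi_Q^\top\Phi_Q$, and, when $G_Q$ is invertible, $R_Q=I_{N_Q}-\Phi_QG_Q^{-1}\Phi_Q^\top$. For an unordered pair $e=(i,j)\subset I_Q$ of distinct indices with $i=i_r$, $j=i_s$, $d_e=e_r-e_s\in\mathbb R^{N_Q}$. For $h>0$, on cells with $\lambda_{\min}(G_Q/N_Q)\ge\kappa$, $\mathcal E_Q(h)=\{(i,j)\subset I_Q:\|U_i-U_j\|_\infty\le h,\ d_e^\top R_Qd_e\ge v_0\}$. $\mathcal C_n(h)$ is the collection of cells $Q\in\mathcal Q_n$ with $N_Q=q+2$, $\lambda_{\min}(G_Q/N_Q)\ge\kappa$ and $\mathcal E_Q(h)\ne\varnothing$. *)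

(* Defs.v *)
From HB Require Import structures.
From mathcomp Require Import all_boot all_order all_algebra.
(* The notations of mpoly clash with those of MathComp-Analysis. *)
From mathcomp Require Import -(notations) mpoly.
From mathcomp Require Import all_classical all_reals all_analysis.

Set Implicit Arguments.
Unset Strict Implicit.
Unset Printing Implicit Defensive.

Import Order.TTheory GRing.Theory Num.Theory.
Import numFieldNormedType.Exports.

Local Open Scope classical_set_scope.
Local Open Scope ring_scope.


Section row_measurable.
Context (R : realType) (n : nat).

Definition row_coord (j : 'I_n) (x : 'rV[R]_n) : R := x 0 j.

Let row_set0 : g_sigma_preimage row_coord set0.
Proof. exact: sigma_algebra0. Qed.

Let row_setC A : g_sigma_preimage row_coord A ->
  g_sigma_preimage row_coord (~` A).
Proof. exact: sigma_algebraC. Qed.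

Let row_bigcup (F : (set 'rV[R]_n)^nat) :
  (forall i, g_sigma_preimage row_coord (F i)) ->
  g_sigma_preimage row_coord (\bigcup_i (F i)).
Proof. exact: sigma_algebra_bigcup. Qed.

(* The product sigma-algebra, which is also the Borel one. *)
HB.instance Definition _ := @isMeasurable.Build
  (measure_tuple_display default_measure_display)
  'rV[R]_n (g_sigma_preimage row_coord) row_set0 row_setC row_bigcup.

End row_measurable.

Section row_measurable_fun.
Context (R : realType) (d : measure_display) (T : measurableType d).

Lemma measurable_row_coord n (j : 'I_n) :
  measurable_fun [set: 'rV[R]_n] (fun x : 'rV[R]_n => x 0 j).
Proof.
move=> _ Y mY; rewrite setTI; apply: sub_sigma_algebra => /=.
rewrite -bigcup_seq/=; exists j => /=; first by rewrite mem_index_enum.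
by exists Y => //; rewrite setTI.
Qed.

Lemma measurable_fun_row n (f : T -> 'rV[R]_n) :
  (forall j, measurable_fun [set: T] (fun x => f x 0 j)) ->
  measurable_fun [set: T] f.
Proof.
move=> mf _ A mA; rewrite setTI.
suff H : g_sigma_preimage (fun i => @row_coord R n i \o f) `<=` measurable.
  apply: H; rewrite g_sigma_preimage_comp; exists A => //.
  by rewrite setTI.
apply: smallest_sub; first exact: sigma_algebra_measurable.
case: n => [|n] in f mf A mA *; first by rewrite big_ord0.
rewrite -bigcup_mkord_ord; apply: bigcup_sub => i Ii.
by move=> B [C mC <-]; exact: mf.
Qed.

End row_measurable_fun.

Section lebesgue_row.
Context (R : realType).

Definition row_cons n (x : R * 'rV[R]_n) : 'rV[R]_n.+1 :=
  \row_j (if unlift ord0 j is Some k then x.2 0 k else x.1).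

Definition row_uncons n (x : 'rV[R]_n.+1) : R * 'rV[R]_n :=
  (x 0 ord0, \row_j x 0 (lift ord0 j)).

Lemma row_cons0 n (x : R * 'rV[R]_n) : row_cons x 0 ord0 = x.1.
Proof. by rewrite mxE unlift_none. Qed.

Lemma row_consS n (x : R * 'rV[R]_n) j : row_cons x 0 (lift ord0 j) = x.2 0 j.
Proof. by rewrite mxE liftK. Qed.

Lemma row_consK n : cancel (@row_cons n) (@row_uncons n).
Proof.
move=> x; rewrite /row_uncons row_cons0.
by case: x => a b; congr pair; apply/rowP => j; rewrite mxE row_consS.
Qed.

Lemma measurable_row_cons n : measurable_fun setT (@row_cons n).
Proof.
apply: measurable_fun_row => j.
have [k ->|->] := unliftP ord0 j.
  under eq_fun do rewrite row_consS.
  exact: (measurableT_comp (measurable_row_coord k) measurable_snd).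
by under eq_fun do rewrite row_cons0; exact: measurable_fst.
Qed.

Lemma measurable_row_uncons n : measurable_fun setT (@row_uncons n).
Proof.
apply/measurable_fun_pairP; split; first exact: measurable_row_coord.
apply: measurable_fun_row => j /=.
by under eq_fun do rewrite mxE; exact: measurable_row_coord.
Qed.

Section step.
Local Open Scope ereal_scope.
Context (n : nat) (mu : {sigma_finite_measure set 'rV[R]_n -> \bar R}).

Definition lebesgue_row_step : set 'rV[R]_n.+1 -> \bar R :=
  pushforward (lebesgue_measure \x mu) (@row_cons n).

Let mcons : measurable_fun [set: measurableTypeR R * 'rV[R]_n] (@row_cons n).
Proof. exact: measurable_row_cons. Qed.

Let step0 : lebesgue_row_step set0 = 0.
Proof. by rewrite /lebesgue_row_step /pushforward preimage_set0 measure0. Qed.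

Let step_ge0 A : 0 <= lebesgue_row_step A.
Proof. exact: measure_ge0. Qed.

Let step_sigma_additive : semi_sigma_additive lebesgue_row_step.
Proof.
move=> F mF tF mUF; rewrite /lebesgue_row_step /pushforward preimage_bigcup.
apply: measure_semi_sigma_additive.
- by move=> k; rewrite -[X in measurable X]setTI; exact: mcons.
- apply/trivIsetP => /= i j _ _ ij; rewrite -preimage_setI.
  by move/trivIsetP : tF => /(_ _ _ _ _ ij) ->//; rewrite preimage_set0.
- by rewrite -preimage_bigcup -[X in measurable X]setTI; exact: mcons.
Qed.

HB.instance Definition _ := isMeasure.Build _ _ _ lebesgue_row_step
  step0 step_ge0 step_sigma_additive.

Let step_sigma_finite : sigma_finite [set: 'rV[R]_n.+1] lebesgue_row_step.
Proof.
have /sigma_finiteP[F [TF ndF Foo]] := sigma_finiteT (@lebesgue_measure R).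
have /sigma_finiteP[G [TG ndG Goo]] := sigma_finiteT mu.
exists (fun k => @row_uncons n @^-1` (F k `*` G k)).
  rewrite -preimage_bigcup -[LHS](preimage_setT (@row_uncons n)); congr preimage.
  rewrite -setXTT TF TG; apply/seteqP; split => -[x y] /=; last first.
    by move=> [k _ [/= Fx Gy]]; split; exists k.
  move=> [[k _ Fx] [m _ Gy]]; exists (maxn k m) => //; split => /=.
  - by move: x Fx; exact/subsetPset/ndF/leq_maxl.
  - by move: y Gy; exact/subsetPset/ndG/leq_maxr.
move=> k; have [mF muF] := Foo k; have [mG muG] := Goo k; split.
  rewrite -[X in measurable X]setTI; apply: measurable_row_uncons => //.
  exact: measurableX.
rewrite /lebesgue_row_step /pushforward -comp_preimage.
rewrite (_ : _ \o _ = id); last by apply/funext => x /=; exact: row_consK.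
by rewrite preimage_id product_measure1E// lte_mul_pinfty// ge0_fin_numE.
Qed.

HB.instance Definition _ := Measure_isSigmaFinite.Build _ _ _ lebesgue_row_step
  step_sigma_finite.

End step.

Fixpoint lebesgue_row n : {sigma_finite_measure set 'rV[R]_n -> \bar R} :=
  if n is m.+1 then lebesgue_row_step (lebesgue_row m) else \d_(0 : 'rV[R]_0).

Lemma lebesgue_row_box n (a b : 'rV[R]_n) : (forall j, a 0 j <= b 0 j) ->
  lebesgue_row n [set x : 'rV[R]_n | forall j, x 0 j \in `[a 0 j, b 0 j]] =
  (\prod_j (b 0 j - a 0 j))%:E.
Proof.
elim: n a b => [|n IHn] a b ab.
  by rewrite big_ord0 /= diracE mem_set// => -[].
rewrite /= /lebesgue_row_step /pushforward.
pose a' := (row_uncons a).2; pose b' := (row_uncons b).2.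
rewrite (_ : _ @^-1` _ = `[a 0 ord0, b 0 ord0]%classic `*`
    [set x : 'rV[R]_n | forall j, x 0 j \in `[a' 0 j, b' 0 j]]%R); last first.
  apply/seteqP; split => [[x y] /= H|[x y] /= [H0 H] j].
    split; first by have := H ord0; rewrite row_cons0.
    by move=> j; have := H (lift ord0 j); rewrite row_consS !mxE.
  have [k ->|->] := unliftP ord0 j; last by rewrite row_cons0.
  by have := H k; rewrite row_consS !mxE.
rewrite product_measure1E//; last first.
  rewrite (_ : [set x | _] =
    \bigcap_(j in [set: 'I_n]) (fun x : 'rV[R]_n => x 0 j) @^-1`
      `[a' 0 j, b' 0 j]%classic); last first.
    by apply/seteqP; split => x /= H j *; exact: H.
  apply: fin_bigcap_measurable => // j _.
  by rewrite -[X in measurable X]setTI; exact: measurable_row_coord.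
have ab' j : a' 0 j <= b' 0 j by rewrite !mxE.
rewrite IHn// big_ord_recl EFinM; congr (_ * _)%E; last first.
  by congr EFin; apply: eq_bigr => j _; rewrite !mxE.
apply: (etrans (lebesgue_measure_itv `[a 0 ord0, b 0 ord0])).
rewrite /= lte_fin; have := ab ord0; rewrite le_eqVlt => /orP[/eqP ->|->//].
by rewrite ltxx subrr.
Qed.

End lebesgue_row.


Section holder.
Context (R : realType) (d : nat).
Implicit Types (g : 'rV[R]_d -> R) (U : set 'rV[R]_d).

(* The norm `|x| that the library puts on 'rV[R]_d is the sup norm. *)
Definition euclid_norm (x : 'rV[R]_d) : R := Num.sqrt (\sum_j x 0 j ^+ 2).

Definition cube : set 'rV[R]_d := [set x | forall j, x 0 j \in `[0, 1]].

Definition partial (j : 'I_d) g : 'rV[R]_d -> R :=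
  fun x => 'D_(delta_mx 0 j) g x.

Definition iter_partial (w : seq 'I_d) g : 'rV[R]_d -> R := foldr partial g w.

Definition partial_multi (nu : multinom d) g : 'rV[R]_d -> R :=
  iter_partial (flatten [seq nseq (nu j) j | j <- enum 'I_d]) g.

Definition class_C (k : nat) U g : Prop :=
  forall w : seq 'I_d, (size w <= k)%N ->
    (forall x, U x -> {for x, continuous (iter_partial w g)}) /\
    ((size w < k)%N ->
      forall j x, U x -> derivable (iter_partial w g) x (delta_mx 0 j)).

Definition holder_order (s : R) : nat := `|Num.ceil s|%N.-1.

Definition holder_exponent (s : R) : R := s - (holder_order s)%:R.

Definition Linfty_norm U g : \bar R :=
  Lnorm (lebesgue_row R d) +oo%E (EFin \o (g \_ U)).

Definition holder_seminorm (a : R) U g : \bar R :=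
  ereal_sup [set z | exists x y, [/\ U x, U y, x != y &
    z = (`|g x - g y| / euclid_norm (x - y) `^ a)%:E]].

Definition holder_norm (s : R) U g : \bar R :=
  let l := holder_order s in
  (\sum_(nu : bmultinom d l.+1) Linfty_norm U (partial_multi nu g) +
   \big[maxe/0]_(nu : bmultinom d l.+1 | mdeg nu == l)
     holder_seminorm (holder_exponent s) U (partial_multi nu g))%E.

(* Functions on U are represented by total functions, and only their values on
   the open set U matter. *)
Definition holder_ball (s L : R) U : set ('rV[R]_d -> R) :=
  [set g | class_C (holder_order s) U g /\ (holder_norm s U g <= L%:E)%E].

End holder.


Section model.
Context (R : realType) (d : nat).

(* Densities, regression functions and kernels are total; only their values on
   the cube are constrained and used. *)
Record model_param := ModelParam {
  dens : 'rV[R]_d -> R;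
  regr : 'rV[R]_d -> R;
  nvar : R;
  noise : R.-pker 'rV[R]_d ~> R }.

Local Notation mu := (lebesgue_row R d).
Local Notation cube := (@cube R d).

Definition Theta (pl pu L vl vu M4 : R) (U : set 'rV[R]_d)
    (beta_b beta_g : R) : set model_param :=
  [set theta |
    [/\ (\int[mu]_(x in cube) (dens theta x)%:E = 1)%E,
        (exists2 g, holder_ball beta_g L U g & {in cube, dens theta =1 g}) /\
          (forall x, cube x -> pl <= dens theta x <= pu),
        exists2 g, holder_ball beta_b L U g & {in cube, regr theta =1 g},
        (* N is a null set of the measure p(x)dx on the cube *)
        exists N : set 'rV[R]_d,
          [/\ measurable N,
              (\int[mu]_(x in cube `&` N) (dens theta x)%:E = 0)%E &
              forall x, cube x -> ~ N x ->
                [/\ (\int[noise theta x]_u u%:E = 0)%E,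
                    (\int[noise theta x]_u (u ^+ 2)%:E = (nvar theta)%:E)%E &
                    (\int[noise theta x]_u (u ^+ 4)%:E <= M4%:E)%E]] &
        0 < nvar theta /\ vl <= nvar theta <= vu]].

(* The law of (X, f X + eps) with X ~ p and eps | X = x ~ Q_x. *)
Definition obs_law (theta : model_param) (A : set ('rV[R]_d * R)) : \bar R :=
  (\int[mu]_(x in cube)
    ((dens theta x)%:E * noise theta x [set u | A (x, regr theta x + u)%R]))%E.

Context (disp : measure_display) (Omega : measurableType disp).
Context (P : probability Omega R).

Definition mutually_independent (n : nat)
    (Z : 'I_n -> {RV P >-> ('rV[R]_d * R)%type}) : Prop :=
  forall A : 'I_n -> set ('rV[R]_d * R), (forall i, measurable (A i)) ->
    P (\bigcap_(i in [set: 'I_n]) Z i @^-1` A i) =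
    (\prod_(i < n) P (Z i @^-1` A i))%E.

Definition iid_sample (theta : model_param) (n : nat)
    (Z : 'I_n -> {RV P >-> ('rV[R]_d * R)%type}) : Prop :=
  (forall i A, measurable A -> distribution P (Z i) A = obs_law theta A) /\
  mutually_independent Z.

End model.


Section partition.
Context (R : realType) (d : nat).

(* Ties are rounded up. *)
Definition round (y : R) : int := Num.floor (y + 2^-1).

Definition partition_level (lambda0 : R) (n : nat) : nat :=
  absz (Num.max 0 (round (ln (n%:R / lambda0) / ln 2))).

Definition level_split (r : nat) (s : 'I_d -> nat) : Prop :=
  (\sum_j s j = r)%N /\ forall i j, (s i <= (s j).+1)%N.

Definition cell (s : 'I_d -> nat) := {dffun forall j : 'I_d, 'I_(2 ^ s j)}.

Context (s : 'I_d -> nat).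
Implicit Types (Q : cell s) (x : 'rV[R]_d).

Definition cell_side : 'rV[R]_d := \row_j (2 ^+ s j)^-1.

Definition cell_corner Q : 'rV[R]_d := \row_j ((Q j)%:R / 2 ^+ s j).

(* Half-open intervals, the last one in each coordinate being closed, so that
   the cells partition the closed cube. *)
Definition in_cell Q x : bool :=
  [forall j, (cell_corner Q 0 j <= x 0 j < cell_corner Q 0 j + cell_side 0 j)
    || ((Q j).+1 == 2 ^ s j)%N && (x 0 j == 1)].

Definition rescale Q x : 'rV[R]_d :=
  \row_j ((x 0 j - cell_corner Q 0 j) / cell_side 0 j).

End partition.


Definition poly_basis (R : realType) (d l q : nat) (psi : 'I_q -> mpoly d R) :=
  (forall k, (msize (psi k) <= l.+1)%N) /\
  (forall p : mpoly d R, (msize p <= l.+1)%N ->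
    exists! c : 'rV[R]_q, p = \sum_k c 0 k *: psi k).

(* Used on symmetric matrices, whose set of eigenvalues is finite and nonempty
   in positive dimension. *)
Definition lambda_min (R : realType) (m : nat) (A : 'M[R]_m) : R :=
  inf [set a | eigenvalue A a].

Section cell_quantities.
Context (R : realType) (d q : nat) (psi : 'I_q -> mpoly d R).
Context (s : 'I_d -> nat) (n : nat) (X : 'I_n -> 'rV[R]_d) (Q : cell s).

Definition cell_indices : {set 'I_n} := finset (fun i => in_cell Q (X i)).

Local Notation N := #|cell_indices|.

(* enum_val lists the indices in increasing order. *)
Definition cell_point (r : 'I_N) : 'rV[R]_d := rescale Q (X (enum_val r)).

Definition design : 'M[R]_(N, q) :=
  \matrix_(r, k) meval (fun j => cell_point r 0 j) (psi k).

Definition gram : 'M[R]_q := design^T *m design.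

Definition residual : 'M[R]_N := 1%:M - design *m invmx gram *m design^T.

Definition pair_vec (e : 'I_N * 'I_N) : 'cV[R]_N :=
  delta_mx e.1 0 - delta_mx e.2 0.

(* The unordered pair (i_r, i_t) of sample indices is encoded by the positions
   r < t; `|_| is the sup norm. *)
Definition edges (v0 h : R) : {set 'I_N * 'I_N} :=
  finset (fun e : 'I_N * 'I_N =>
    [&& (e.1 < e.2)%N, `|cell_point e.1 - cell_point e.2| <= h &
        v0 <= ((pair_vec e)^T *m residual *m pair_vec e) 0 0]).

Definition good_cell (kappa v0 h : R) : bool :=
  [&& N == q.+2, kappa <= lambda_min (N%:R^-1 *: gram) & edges v0 h != finset.set0].

End cell_quantities.

Definition good_cells (R : realType) (d q : nat) (psi : 'I_q -> mpoly d R)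
    (s : 'I_d -> nat) (n : nat) (X : 'I_n -> 'rV[R]_d) (kappa v0 h : R) :
    {set cell s} :=
  finset (fun Q => good_cell psi X Q kappa v0 h).

(* Main.v *)
Require Import Defs.
From HB Require Import structures.
From mathcomp Require Import all_boot all_order all_algebra.
From mathcomp Require Import -(notations) mpoly.
From mathcomp Require Import (canonicals) complex.
From mathcomp Require Import all_classical all_reals all_analysis.
From mathcomp Require Import measurable_realfun.
From mathcomp Require Import ring lra zify.
Import Order.TTheory GRing.Theory Num.Theory.
Import numFieldNormedType.Exports.
Local Open Scope classical_set_scope.
Local Open Scope ring_scope.
Set Implicit Arguments.
Unset Strict Implicit.
Unset Printing Implicit Defensive.

(** Each cell receives about [lambda0] points on average, so a fixed positive
    proportion of the cells contains exactly [q + 2] of them.  Two of these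
    points can be asked to be [t]-close and the other [q] to sit near nodes
    that determine the polynomials of the model; given the occupation numbers,
    this happens independently in the different cells, with probability of
    order [t ^ d].  The number of good cells is thus about [n * t ^ d], with
    binomial-like lower tails.

    _Deterministic part_.  A basis of polynomials is linearly independent on
    the cube ([mpoly_neq0_cube]), so [q] nodes of the cube make its evaluation
    matrix invertible ([unisolvent_points]), and small boxes around the nodes
    keep it uniformly invertible ([unisolvent_boxes]).  When [q] of the [q + 2]
    points of a cell lie in these boxes, the Gram matrix is bounded below
    ([lambda_min_gram]), and so is the residual energy of the difference of the
    two remaining points, wherever they are in the cell ([residual_pair_ge]): a
    polynomial close to 1 at one of them must be large at some node.  The
    constants kappa and v0 come from these two bounds, and closeness of the pair
    is a separate requirement.

    _Discretization_.  Each observation is replaced by a label in a finite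
    type: its cell, the box of a grid of mesh [1 / M] (with [M] of order
    [1 / t]) that contains its rescaled position, and the node boxes that
    contain it.  A cell is hit when it has [q + 2] points, the first two of
    them share a grid box, and the next ones lie in the successive node boxes;
    hit cells are good ([hit_cells_good]).  The labels are independent, so the
    tail becomes a finite sum of products of label probabilities
    ([sample_prob_le]), which are estimated by volumes of boxes.

    _Tail of the number of hits_.  Given the cells of the points, hits of
    distinct cells are independent, so the mean of [exp (- hits)] is at most
    that of [exp (- delta / 2 * K)], where [K] is the number of cells with
    [q + 2] points and [delta], of order [t ^ d], bounds below the conditional
    probability of a hit ([sum_hits]).  Moving one point changes [K] by at most
    2, so the exponential bound of the method of bounded differences applies
    ([bounded_differences_mgf]); since [delta] is small, the quadratic term
    [n * delta ^ 2] is negligible compared with [delta * E K], which is of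
    order [n * t ^ d] ([occupancy_tail]).

    _Measurability_.  The probability of the event in the statement is
    controlled only because this event is measurable.  The delicate condition
    is the one on the smallest eigenvalue, which is rewritten with the
    coefficients of a characteristic polynomial ([lambda_min_char_poly]). *)

(** * Smallest eigenvalues and least squares residuals *)

Lemma hermitian_eigenvalue_real (C : numClosedFieldType) q (A : 'M[C]_q) z :
  A^T = map_mx Num.conj A -> eigenvalue A z -> z \is Num.real.
Proof.
move=> hA /eigenvalueP[v vA v0].
pose w := (map_mx Num.conj v)^T.
have n0 : (v *m w) 0 0 != 0.
  apply: contraNneq v0 => vw0; apply/eqP/rowP => i; rewrite mxE; apply/eqP.
  have h j : 0 <= v 0 j * w j 0 by rewrite !mxE -normCK exprn_ge0.
  have := vw0; rewrite mxE => /eqP; rewrite psumr_eq0// => /allP/(_ i).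
  rewrite mem_index_enum => /(_ isT); rewrite !mxE -normCK expf_eq0/= normr_eq0.
  by [].
have wE : map_mx Num.conj w = v^T.
  by apply/matrixP => i j; rewrite !mxE conjCK.
have eq1 : (v *m A *m w) 0 0 = z * (v *m w) 0 0 by rewrite vA -scalemxAl mxE.
have sym (B : 'M[C]_1) : B 0 0 = B^T 0 0 by rewrite mxE.
have conj00 (B : 'M[C]_1) : Num.conj (B 0 0) = (map_mx Num.conj B) 0 0 by rewrite mxE.
have eq2 : Num.conj ((v *m A *m w) 0 0) = (v *m A *m w) 0 0.
  by rewrite conj00 !map_mxM/= wE -hA sym !trmx_mul !trmxK mulmxA.
have eq3 : Num.conj ((v *m w) 0 0) = (v *m w) 0 0.
  by rewrite conj00 !map_mxM/= wE sym !trmx_mul !trmxK.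
rewrite CrealE; apply/eqP; apply: (mulIf n0); rewrite -eq1 -eq2 eq1 rmorphM/=.
by rewrite eq3.
Qed.

(** The characteristic polynomial splits over the complex numbers, and its
    roots are eigenvalues of a Hermitian matrix, hence real. *)
Lemma symmetric_char_poly_split (R : realType) q (A : 'M[R]_q) : A^T = A ->
  exists rs : seq R, char_poly A = \prod_(z <- rs) ('X - z%:P).
Proof.
move=> hA.
pose C : numClosedFieldType := complex.complex R.
pose f : {rmorphism R -> C} := @complex.real_complex_def R (Phant R).
have creal (z : C) : z \is Num.real -> z = f (complex.Re z).
  by case: z => a b; rewrite realE !complex.lecE/= => /orP[|] /andP[/eqP ? _]; subst.
have [rs rsE] := closed_field_poly_normal (map_poly f (char_poly A)).
have mon : map_poly f (char_poly A) \is monic by rewrite monic_map// char_poly_monic.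
rewrite (monicP mon) scale1r in rsE.
exists (map (@complex.Re R) rs); rewrite big_map.
apply: (map_inj_poly (@complex.complexI R)) => //.
rewrite -/f rsE rmorph_prod/=; rewrite !big_seq; apply: eq_bigr => z zrs.
rewrite map_polyXsubC; congr ('X - _%:P); apply: creal.
apply: (@hermitian_eigenvalue_real _ _ (map_mx f A)).
  apply/matrixP => i j; rewrite -[in RHS]hA !mxE/=.
  by apply/esym/eqP; rewrite -CrealE realE !complex.lecE/= eqxx/= le_total.
by rewrite eigenvalue_root_char -map_char_poly rsE root_prod_XsubC.
Qed.

(** An infimum of reals is 0 on the empty set and on unbounded sets; the
    splitting of the characteristic polynomial excludes both cases here. *)
Lemma lambda_minP (R : realType) q (A : 'M[R]_q) (k : R) : (0 < q)%N ->
  A^T = A -> (k <= lambda_min A) <-> (forall a, eigenvalue A a -> k <= a).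
Proof.
move=> q0 /symmetric_char_poly_split[rs rsE].
have memE a : eigenvalue A a = (a \in rs).
  by rewrite eigenvalue_root_char rsE root_prod_XsubC.
have rs0 : rs != [::].
  apply/eqP => rs0; have := size_char_poly A.
  by rewrite rsE size_prod_XsubC rs0 => -[] q0'; rewrite -q0' in q0.
have ne : [set a | eigenvalue A a] !=set0.
  case: rs rs0 {rsE} memE => // a rs _ memE; exists a => /=.
  by rewrite memE mem_head.
split=> [kA a ea|h]; last by apply: lb_le_inf => // a /= /h.
apply: le_trans kA _; apply: ge_inf => //.
exists (- \sum_(x <- rs) `|x|) => b /=; rewrite memE => brs.
rewrite (big_rem b)//= opprD; apply: (le_trans _ (lerNnormlW (lexx `|b|))).
by rewrite gerBl sumr_ge0.
Qed.

Lemma lambda_min_ge (R : realType) q (A : 'M[R]_q) (k : R) : (0 < q)%N ->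
  A^T = A ->
  (forall v : 'rV_q, k * (v *m v^T) 0 0 <= (v *m A *m v^T) 0 0) ->
  k <= lambda_min A.
Proof.
move=> q0 Asym h; apply/lambda_minP => // a /eigenvalueP[v vA v0].
have := h v; rewrite vA -scalemxAl [X in _ <= X]mxE ler_pM2r//.
rewrite mxE lt_def sumr_ge0 ?andbT; last by move=> i _; rewrite mxE -expr2 sqr_ge0.
apply: contraNneq v0 => /eqP; rewrite psumr_eq0; last first.
  by move=> i _; rewrite mxE -expr2 sqr_ge0.
move=> /allP H; apply/eqP/rowP => i; have := H i (mem_index_enum _).
by rewrite !mxE -expr2 sqrf_eq0 => /eqP.
Qed.

(** The eigenvalues of [k - A] are all nonpositive exactly when its
    characteristic polynomial, which splits over the reals and is monic, has
    nonnegative coefficients.  Coefficients are polynomial in the entries of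
    [A], so this turns the eigenvalue condition into a measurable one. *)
Lemma lambda_min_char_poly (R : realType) q (A : 'M[R]_q) (k : R) : (0 < q)%N ->
  A^T = A ->
  (k <= lambda_min A) <-> (forall i, 0 <= (char_poly (k%:M - A))`_i).
Proof.
move=> q0 Asym; rewrite lambda_minP//.
have Bsym : (k%:M - A)^T = k%:M - A by rewrite linearB/= tr_scalar_mx Asym.
have shift a : eigenvalue A a = eigenvalue (k%:M - A) (k - a).
  apply/eigenvalueP/eigenvalueP => -[v vA v0]; exists v => //.
    by rewrite mulmxBr mul_mx_scalar vA scalerBl.
  have : v *m (k%:M - (k%:M - A)) = a *: v.
    by rewrite mulmxBr vA mul_mx_scalar -scalerBl opprB addrC subrK.
  by rewrite opprB addrC subrK.
split=> [h|h a ea].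
  have [rs rsE] := symmetric_char_poly_split Bsym.
  have : forall z, z \in rs -> z <= 0.
    move=> z zrs; rewrite -[z](opprK z) oppr_le0 -(lerDl k); apply: h.
    by rewrite shift opprD opprK addrA subrr add0r eigenvalue_root_char rsE
      root_prod_XsubC.
  rewrite rsE; elim: rs {rsE} => [_ i|z rs IH hz i].
    by rewrite big_nil coef1 ler0n.
  rewrite big_cons mulrBl coefB coefXM coefCM subr_ge0.
  have IH' := IH (fun y yrs => hz y (mem_behead (s := z :: rs) yrs)).
  apply: (@le_trans _ _ 0); last by case: ifP.
  by rewrite mulr_le0_ge0// hz// mem_head.
rewrite leNgt; apply/negP => ak; move: ea.
rewrite shift eigenvalue_root_char rootE; apply/negP.
set p := char_poly _ in h *.
have := char_poly_monic (k%:M - A); rewrite -/p => /monicP.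
rewrite lead_coefE size_char_poly /= => pm.
rewrite gt_eqF// horner_coef size_char_poly big_ord_recr/= pm mul1r.
have ka : 0 < k - a by rewrite subr_gt0.
rewrite ltr_wpDl ?exprn_gt0// sumr_ge0// => i _.
by rewrite mulr_ge0// exprn_ge0// ltW.
Qed.

Section least_squares.
Context (R : realType).

Lemma sqr_1B_ge (y : R) : y ^+ 2 <= 4^-1 -> 4^-1 <= (1 - y) ^+ 2.
Proof.
move=> y4; have y2 : y <= 2^-1.
  by rewrite leNgt; apply/negP => h; nra.
have y1 : 2^-1 <= 1 - y by lra.
by rewrite (_ : 4^-1 = 2^-1 ^+ 2) ?lerXn2r ?nnegrE//; lra.
Qed.

Lemma sqnormE N (x : 'cV[R]_N) : (x^T *m x) 0 0 = \sum_r x r 0 ^+ 2.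
Proof. by rewrite mxE; apply: eq_bigr => r _; rewrite mxE expr2. Qed.

Lemma sqnorm_ge0 N (x : 'cV[R]_N) : 0 <= (x^T *m x) 0 0.
Proof. by rewrite sqnormE sumr_ge0// => r _; rewrite sqr_ge0. Qed.

Lemma sqnorm_eq0 N (x : 'cV[R]_N) : (x^T *m x) 0 0 <= 0 -> x = 0.
Proof.
move=> x0; have /eqP : (x^T *m x) 0 0 = 0 by apply/le_anti; rewrite x0 sqnorm_ge0.
rewrite sqnormE.
rewrite psumr_eq0; last by move=> r _; rewrite sqr_ge0.
move=> /allP H; apply/colP => i; have := H i (mem_index_enum _).
by rewrite !mxE sqrf_eq0 => /eqP.
Qed.

Context (N q : nat) (Phi : 'M[R]_(N, q)) (lam : R).
Hypothesis lam_gt0 : 0 < lam.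
Hypothesis Phi_ge : forall c : 'cV[R]_q,
  lam * (c^T *m c) 0 0 <= ((Phi *m c)^T *m (Phi *m c)) 0 0.

Lemma gram_unit : Phi^T *m Phi \in unitmx.
Proof.
rewrite -unitmx_tr -row_free_unit; apply/row_freeP.
suff: kermx (Phi^T *m Phi)^T = 0.
  move=> k0; apply/row_freeP; rewrite -kermx_eq0 k0//.
apply/row_matrixP => i; rewrite row0; set v := row i _.
have : v *m (Phi^T *m Phi)^T = 0 by apply/sub_kermxP; exact: row_sub.
move=> /(congr1 trmx); rewrite trmx_mul trmx0 => Gv.
have := Phi_ge v^T; rewrite trmx_mul -mulmxA (mulmxA Phi^T Phi v^T).
rewrite -[Phi^T *m Phi]trmxK Gv mulmx0 [X in _ <= X]mxE pmulr_rle0//.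
move=> /sqnorm_eq0 /(congr1 trmx).
by rewrite trmxK trmx0.
Qed.

Lemma lambda_min_gram : (0 < q)%N -> (0 < N)%N ->
  lam / N%:R <= lambda_min (N%:R^-1 *: (Phi^T *m Phi)).
Proof.
move=> q0 N0; apply: lambda_min_ge => //.
  by rewrite linearZ/= trmx_mul trmxK.
move=> v; rewrite -scalemxAr -scalemxAl [X in _ <= X]mxE mulrAC mulrC.
rewrite ler_wpM2l ?invr_ge0//; have := Phi_ge v^T.
by rewrite trmx_mul !trmxK !mulmxA.
Qed.

(** The residual matrix is a symmetric idempotent: its quadratic form is the
    squared distance to the fitted vector. *)
Lemma residual_quad (R' := 1%:M - Phi *m invmx (Phi^T *m Phi) *m Phi^T)
    (x : 'cV[R]_N) :
  exists c : 'cV[R]_q,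
    (x^T *m R' *m x) 0 0 = ((x - Phi *m c)^T *m (x - Phi *m c)) 0 0.
Proof.
pose G := Phi^T *m Phi; exists (invmx G *m (Phi^T *m x)).
have Gsym : G^T = G by rewrite trmx_mul trmxK.
have R'x : x - Phi *m (invmx G *m (Phi^T *m x)) = R' *m x.
  by rewrite mulmxBl mul1mx !mulmxA.
have R's : R'^T = R'.
  by rewrite linearB/= trmx1 !trmx_mul trmxK trmx_inv -/G Gsym mulmxA.
have R'R' : R' *m R' = R'.
  rewrite {1}/R' mulmxBl mul1mx /R' mulmxBr mulmx1.
  rewrite [X in _ - (_ - X)](_ : _ = Phi *m invmx G *m Phi^T) ?subrr ?subr0//.
  rewrite -!mulmxA; congr (_ *m _); rewrite !mulmxA -/G; congr (_ *m _).
  by rewrite -[X in X *m _]mulmxA -/G mulVmx ?gram_unit// mul1mx.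
by rewrite R'x trmx_mul R's mulmxA -(mulmxA _ R' R') R'R'.
Qed.

(** If the residual energy of [delta_i - delta_j] were small, the fitted vector
    [Phi c] would be close to 1 at [i], which forces [c] to be of order one,
    and small away from [i] and [j], which forces [c] to be small.  The two
    terms of the minimum correspond to [c] being short or long. *)
Lemma residual_pair_ge (B : R) (i j : 'I_N) : i != j -> 0 < B ->
  (forall c : 'cV[R]_q, (Phi *m c) i 0 ^+ 2 <= B * (c^T *m c) 0 0) ->
  (forall c : 'cV[R]_q, lam * (c^T *m c) 0 0 <=
     \sum_(r | (r != i) && (r != j)) (Phi *m c) r 0 ^+ 2) ->
  Num.min 4^-1 (lam / (4 * B)) <=
  (((delta_mx i 0 - delta_mx j 0 : 'cV[R]_N)^T *m
   (1%:M - Phi *m invmx (Phi^T *m Phi) *m Phi^T) *m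
   (delta_mx i 0 - delta_mx j 0 : 'cV[R]_N)) 0 0).
Proof.
move=> ij B0 hi hr; have [c ->] := residual_quad (delta_mx i 0 - delta_mx j 0).
rewrite sqnormE (bigD1 i)//=.
set y := (Phi *m c) i 0; set x := (c^T *m c) 0 0.
have x0 : 0 <= x by exact: sqnorm_ge0.
have yx : y ^+ 2 <= B * x by exact: hi.
have E r (z : 'cV[R]_N) :
  (delta_mx i 0 - delta_mx j 0 - z) r 0 = (r == i)%:R - (r == j)%:R - z r 0.
  by rewrite !mxE !andbT.
rewrite E eqxx (negbTE ij) subr0 -/y.
have : lam * x <= \sum_(r | r != i) (delta_mx i 0 - delta_mx j 0 - Phi *m c) r 0 ^+ 2.
  apply: le_trans (hr c) _; rewrite [X in _ <= X](bigID (pred1 j))/=.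
  apply: ler_wpDl; first by rewrite sumr_ge0// => r _; rewrite sqr_ge0.
  apply: ler_sum => r /andP[ri rj].
  by rewrite E (negbTE ri) (negbTE rj) subrr sub0r sqrrN.
set S := \sum_(_ | _) _ => lS.
rewrite ge_min; have [x4|x4] := leP x (4 * B)^-1.
  apply/orP; left.
  have : y ^+ 2 <= 4^-1.
    apply: le_trans yx _; rewrite -ler_pdivlMl//; apply: le_trans x4 _.
    by rewrite invfM mulrC.
  have S0 : 0 <= S by rewrite sumr_ge0// => r _; rewrite sqr_ge0.
  by move=> y4; rewrite ler_wpDr// sqr_1B_ge.
apply/orP; right.
have : lam * (4 * B)^-1 <= lam * x by rewrite ler_pM2l// ltW.
by move=> lx; rewrite (le_trans lx)// (le_trans lS)// lerDr sqr_ge0.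
Qed.
End least_squares.

(** * Unisolvent polynomial nodes *)

(** Uniqueness of the expansion in base [D]. *)
Lemma base_expansion_inj (D d : nat) (a b : 'I_d -> nat) :
  (forall j, (a j < D)%N) -> (forall j, (b j < D)%N) ->
  (\sum_j a j * D ^ j = \sum_j b j * D ^ j)%N -> a =1 b.
Proof.
elim: d a b => [|d IH] a b aD bD; first by move=> _ [].
rewrite !big_ord_recl !expn0 !muln1.
have shift (c : 'I_d.+1 -> nat) : (\sum_(i < d) c (lift ord0 i) * D ^ bump 0 i =
    (\sum_(i < d) c (lift ord0 i) * D ^ i) * D)%N.
  rewrite big_distrl/=; apply: eq_bigr => i _.
  by rewrite /bump/= add1n expnSr mulnA.
rewrite /= !shift => E.
have E0 : a ord0 = b ord0.
  have := congr1 (modn^~ D) E; rewrite /= ![(_ + _ * D)%N]addnC !modnMDl.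
  by rewrite !modn_small.
move/eqP: E; rewrite E0 eqn_add2l eqn_pmul2r; last by rewrite (leq_trans _ (aD ord0)).
move=> /eqP /(IH (fun i => a (lift ord0 i)) (fun i => b (lift ord0 i))) => IH'.
by move=> j; case: (unliftP ord0 j) => [k|] -> //; apply: IH'.
Qed.

(** Kronecker substitution: along the curve [x |-> (x ^ (D ^ j))_j], with [D]
    larger than the degree, distinct monomials become distinct powers of [x],
    so a nonzero polynomial becomes a nonzero univariate one, which has
    finitely many roots. *)
Lemma mpoly_neq0_cube (R : realType) (d : nat) (p : mpoly d R) : p != 0 ->
  exists2 u : 'rV[R]_d, cube u & meval (fun j => u 0 j) p != 0.
Proof.
pose D := msize p; pose e (m : multinom d) := (\sum_j m j * D ^ j)%N.
pose P : {poly R} := \sum_(m <- msupp p) mcoeff m p *: 'X^(e m).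
have e_inj : {in msupp p &, injective e}.
  move=> m m' mp mp' /base_expansion_inj H; apply/mnmP; apply: H => j.
    apply: leq_ltn_trans (msize_mdeg_lt mp); rewrite mdegE (bigD1 j)//=.
    exact: leq_addr.
  apply: leq_ltn_trans (msize_mdeg_lt mp'); rewrite mdegE (bigD1 j)//=.
  exact: leq_addr.
pose curve (x : R) : 'rV[R]_d := \row_j x ^+ (D ^ j).
have evalE x : meval (fun j => curve x 0 j) p = P.[x].
  rewrite mevalE horner_sum; apply: eq_bigr => m _.
  rewrite hornerZ hornerXn -prodrXr; congr (_ * _); apply: eq_bigr => j _.
  by rewrite mxE -exprM mulnC.
(* More points of the unit interval than P can have roots. *)
move=> p0; pose rs : seq R := [seq (i.+1%:R)^-1 | i <- iota 0 (size P)].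
have [/allP rsP|] := boolP (all (root P) rs); last first.
  move=> /allPn[_ /mapP[i _ ->]] iP; exists (curve i.+1%:R^-1); last by rewrite evalE.
  move=> j; rewrite mxE in_itv/= exprn_ge0 ?invr_ge0//= exprn_ile1 ?invr_ge0//.
  by rewrite invf_le1 ?ltr0n// ler1n.
suff P0 : P = 0.
  have [m mp] : exists m, m \in msupp p.
    by case: (msupp p) (msupp_eq0 p) (negbTE p0) => [<-//|m s _ _]; exists m; rewrite mem_head.
  have : P`_(e m) = mcoeff m p.
    rewrite coef_sum (bigD1_seq m)//= ?msupp_uniq// coefZ coefXn eqxx mulr1.
    rewrite big_seq_cond big1 ?addr0// => m' /andP[m'p m'm].
    rewrite coefZ coefXn; case: eqP => [E|]; last by rewrite mulr0.
    by rewrite (e_inj _ _ mp m'p E) eqxx in m'm.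
  by rewrite P0 coef0 => /esym/eqP; rewrite mcoeff_eq0 mp.
apply: (@roots_geq_poly_eq0 _ _ rs).
- by apply/allP.
- rewrite map_inj_uniq ?iota_uniq// => i j /invr_inj /eqP.
  by rewrite eqr_nat eqSS => /eqP.
- by rewrite size_map size_iota.
Qed.

(** The evaluation rows are built one at a time: while there are fewer than
    [q] of them, some nonzero [c] is orthogonal to all, and a point where the
    combination with coefficients [c] does not vanish gives a new independent
    row. *)
Lemma unisolvent_points (F : fieldType) (T : Type) (A : T -> Prop) q
    (f : 'I_q -> T -> F) :
  (forall c : 'cV[F]_q, c != 0 -> exists2 x, A x & \sum_k f k x * c k 0 != 0) ->
  exists x : 'I_q -> T, (forall r, A (x r)) /\
    \matrix_(r, k) f k (x r) \in unitmx.
Proof.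
move=> Hf.
suff: forall m, (m <= q)%N -> exists x : 'I_m -> T, (forall r, A (x r)) /\
    row_free (\matrix_(r < m, k < q) f k (x r)).
  by move=> /(_ q (leqnn q)); under eq_exists do rewrite row_free_unit.
elim=> [_|m IH mq].
  have x : 'I_0 -> T by case.
  by exists x; split; [case|rewrite /row_free flatmx0 mxrank0].
have [x [Ax xfree]] := IH (ltnW mq).
set M := \matrix_(_, _) _ in xfree.
have [c Mc c0] : exists2 c : 'cV[F]_q, M *m c = 0 & c != 0.
  have : kermx M^T != 0.
    by rewrite kermx_eq0 /row_free mxrank_tr (eqP xfree) neq_ltn mq.
  move=> /rowV0Pn[v /sub_kermxP vM v0]; exists v^T.
    by rewrite -[M]trmxK -trmx_mul vM trmx0.
  by rewrite -trmx0 (inj_eq (can_inj (@trmxK _ _ _))).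
have [y Ay yc] := Hf c c0.
pose x' (r : 'I_m.+1) := if unlift ord0 r is Some k then x k else y.
exists x'; split; first by move=> r; rewrite /x'; case: unliftP.
set M' := \matrix_(_, _) _.
have M'E : M' = (col_mx (\row_k f k y) M : 'M[F]_(1 + m, q)).
  apply/matrixP => r k; rewrite !mxE; case: splitP => i ri; rewrite !mxE /x'.
    by rewrite (_ : r = ord0) ?unlift_none//; apply: val_inj; rewrite /= ri ord1.
  rewrite (_ : r = lift ord0 i) ?liftK//; apply: val_inj.
  by rewrite /= ri /bump.
rewrite M'E -kermx_eq0; apply/rowV0P => v /sub_kermxP.
rewrite -[v](@hsubmxK _ 1 1 m) (@mul_row_col _ 1 1 m).
move: (lsubmx _) (rsubmx _) => a w aw0.
have a0 : a = 0.
  have := congr1 (mulmx^~ c) aw0; rewrite mulmxDl -!mulmxA Mc mulmx0 addr0 mul0mx.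
  rewrite [a]mx11_scalar mul_scalar_mx => /(congr1 (fun B : 'M[F]_1 => B ord0 ord0)).
  rewrite !mxE; under eq_bigr do rewrite !mxE.
  by move/eqP; rewrite mulf_eq0 (negbTE yc) orbF => /eqP ->; rewrite raddf0.
move: aw0; rewrite a0 mul0mx add0r -[0 in RHS](mul0mx _ M).
by move=> /(row_free_inj xfree) ->; rewrite row_mx0.
Qed.

Lemma sqr_sum_le (R : realFieldType) q (y : 'I_q -> R) :
  (\sum_r `|y r|) ^+ 2 <= q%:R * \sum_r y r ^+ 2.
Proof.
have E : q%:R * \sum_r y r ^+ 2 = \sum_(r < q) \sum_(s < q) (y r ^+ 2 + y s ^+ 2) / 2.
  under [RHS]eq_bigr do rewrite -mulr_suml big_split/= sumr_const card_ord.
  rewrite -mulr_suml big_split/= sumr_const card_ord sumrMnl -mulr_natl.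
  by field.
rewrite E expr2 big_distrlr/=; apply: ler_sum => r _; apply: ler_sum => s _.
rewrite -[y r ^+ 2]real_normK ?num_real// -[y s ^+ 2]real_normK ?num_real//.
have := sqr_ge0 (`|y r| - `|y s|); rewrite sqrrB; lra.
Qed.

(** A polynomial function is a finite sum of finite products of coordinates. *)
Lemma meval_continuous (R : realType) d (p : mpoly d R) :
  continuous (fun x : 'rV[R]_d => meval (fun j => x 0 j) p).
Proof.
have prodC (m : multinom d) (js : seq 'I_d) :
    continuous (fun x : 'rV[R]_d => \prod_(j <- js) x 0 j ^+ m j).
  elim: js => [|j js IHj].
    rewrite [X in continuous X](_ : _ = cst 1); first exact: cst_continuous.
    by apply/funext => y; rewrite big_nil.
  rewrite [X in continuous X](_ : _ = (fun x : 'rV[R]_d =>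
      x 0 j ^+ m j) \* fun x => \prod_(j <- js) x 0 j ^+ m j); last first.
    by apply/funext => y; rewrite big_cons.
  move=> x; apply: continuousM; last exact: IHj.
  apply: (@continuous_comp _ _ _ (fun x : 'rV[R]_d => x 0 j) (fun y => y ^+ m j)).
    exact: coord_continuous.
  exact: exprn_continuous.
rewrite [X in continuous X](_ : _ = fun x : 'rV[R]_d =>
    \sum_(m <- msupp p) mcoeff m p * \prod_j x 0 j ^+ m j); last first.
  by apply/funext => x; rewrite mevalE.
elim: (msupp p : seq _) => [|m s IH].
  rewrite [X in continuous X](_ : _ = cst 0); first exact: cst_continuous.
  by apply/funext => x; rewrite big_nil.
rewrite [X in continuous X](_ : _ = (fun x : 'rV[R]_d =>
    mcoeff m p * \prod_j x 0 j ^+ m j) \+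
    fun x => \sum_(m <- s) mcoeff m p * \prod_j x 0 j ^+ m j); last first.
  by apply/funext => x; rewrite big_cons.
move=> x; apply: continuousD; last exact: IH.
apply: continuousM.
  exact: cst_continuous.
exact: prodC.
Qed.

Lemma meval_cube_bound (R : realType) d (p : mpoly d R) (x : 'rV[R]_d) : cube x ->
  `|meval (fun j => x 0 j) p| <= \sum_(m <- msupp p) `|mcoeff m p|.
Proof.
move=> cx; rewrite mevalE; apply: le_trans (ler_norm_sum _ _ _) _.
apply: ler_sum => m _; rewrite normrM ler_piMr// normr_prod.
apply: prodr_ile1 => j _; rewrite normr_ge0/= normrX.
have := cx j; rewrite in_itv/= => /andP[x0 x1].
by rewrite exprn_ile1// ger0_norm.
Qed.

Section unisolvent_boxes.
Context (R : realType) (d q : nat) (psi : 'I_q -> mpoly d R).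
Hypothesis psi_free : forall c : 'I_q -> R, \sum_k c k *: psi k = 0 -> forall k, c k = 0.

Definition poly_vec (c : 'cV[R]_q) (x : 'rV[R]_d) : R :=
  \sum_k meval (fun j => x 0 j) (psi k) * c k 0.

Lemma poly_vec_bound : exists2 B : R, 0 < B &
  forall x, cube x -> forall c : 'cV[R]_q, poly_vec c x ^+ 2 <= B * (\sum_k c k 0 ^+ 2).
Proof.
pose M := 1 + \sum_k \sum_(m <- msupp (psi k)) `|mcoeff m (psi k)|.
have M0 : 0 < M.
  by rewrite ltr_pwDl// sumr_ge0// => k _; rewrite sumr_ge0.
exists (M ^+ 2 * q.+1%:R); first by rewrite mulr_gt0 ?exprn_gt0.
move=> x cx c.
have h : `|poly_vec c x| <= M * \sum_k `|c k 0|.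
  apply: le_trans (ler_norm_sum _ _ _) _; rewrite mulr_sumr; apply: ler_sum => k _.
  rewrite normrM ler_wpM2r//; apply: le_trans (meval_cube_bound _ cx) _.
  rewrite /M (bigD1 k)//= addrCA lerDl addr_ge0// sumr_ge0// => j _.
  by rewrite sumr_ge0.
rewrite -real_normK ?num_real//.
apply: (@le_trans _ _ ((M * \sum_k `|c k 0|) ^+ 2)).
  by rewrite lerXn2r ?nnegrE// mulr_ge0 ?(ltW M0)// sumr_ge0.
rewrite exprMn -[X in _ <= X]mulrA ler_wpM2l ?sqr_ge0//.
apply: le_trans (sqr_sum_le _) _; rewrite ler_wpM2r ?ler_nat//.
by rewrite sumr_ge0// => k _; rewrite sqr_ge0.
Qed.

(** Invertibility of the evaluation matrix at the nodes is an open condition: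
    if [W] is its inverse and the entries move by at most [eps], the
    coefficients satisfy [|c| <= b * (|y| + eps * |c|)], where [y] are the
    values at the perturbed nodes and [b] exceeds the sum of the absolute
    values of the entries of [W]. *)
Lemma unisolvent_boxes : exists (u : 'I_q -> 'rV[R]_d) (rho lam : R),
  [/\ 0 < rho <= 1, 0 < lam, forall r, cube (u r) &
  forall x : 'I_q -> 'rV[R]_d,
    (forall r j, `|x r 0 j - u r 0 j| <= rho) ->
    forall c : 'cV[R]_q, lam * (\sum_k c k 0 ^+ 2) <= \sum_r poly_vec c (x r) ^+ 2].
Proof.
pose f k (x : 'rV[R]_d) := meval (fun j => x 0 j) (psi k).
have [c c0|u [cu uu]] := @unisolvent_points R _ (@cube R d) q f.
  have p0 : \sum_k c k 0 *: psi k != 0.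
    apply: contraNneq c0 => p0; apply/eqP/colP => k.
    by rewrite (psi_free p0) mxE.
  have [u cu up] := mpoly_neq0_cube p0; exists u => //.
  apply: contraNneq up => E; rewrite raddf_sum/=; apply/eqP; rewrite -[RHS]E.
  apply: eq_bigr => k _.
  by rewrite mevalZ mulrC.
pose W := invmx (\matrix_(r, k) f k (u r)).
pose b := 1 + \sum_k \sum_r `|W k r|.
have b0 : 0 < b by rewrite ltr_pwDl// sumr_ge0// => k _; rewrite sumr_ge0.
(* With this choice the error term is absorbed by half of the left side. *)
pose eps := (2 * b)^-1.
have eps0 : 0 < eps by rewrite invr_gt0 mulr_gt0.
have rhoP k r : exists rho : R, 0 < rho /\ forall x : 'rV[R]_d,
    (forall j, `|x 0 j - u r 0 j| <= rho) -> `|f k x - f k (u r)| <= eps.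
  have /cvgrPdist_le/(_ _ eps0) := @meval_continuous R d (psi k) (u r).
  move=> /nbhs_ballP[e /= e0 He]; exists (e / 2); split; first by rewrite divr_gt0.
  move=> x xu; rewrite distrC; apply: He; split=> // i j; rewrite ord1 -ball_normE /ball_/= distrC.
  apply: le_lt_trans (xu j) _; rewrite ltr_pdivrMr// ltr_pMr// ltr1n//.
have [rh rhP] := choice (fun kr => rhoP kr.1 kr.2).
pose rho := \big[Num.min/1]_kr rh kr.
exists u, rho, (4 * b ^+ 2 * q.+1%:R)^-1; split => //.
- rewrite bigmin_le_id andbT; apply: lt_bigmin => // i _; exact: (rhP i).1.
- by rewrite invr_gt0 !mulr_gt0 ?exprn_gt0.
move=> x xu c.
have fx k r : `|f k (x r) - f k (u r)| <= eps.
  apply: (rhP (k, r)).2 => j /=; apply: le_trans (xu r j) _.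
  exact: bigmin_le_cond.
pose y r := poly_vec c (x r); pose S := \sum_k `|c k 0|; pose Y := \sum_r `|y r|.
have S0 : 0 <= S by rewrite sumr_ge0.
have Y0 : 0 <= Y by rewrite sumr_ge0.
have ck k : `|c k 0| <= (\sum_r `|W k r|) * (Y + eps * S).
  have -> : c k 0 = \sum_r W k r * (\sum_l f l (u r) * c l 0).
    rewrite -[in LHS](mulKmx uu c) mxE; apply: eq_bigr => r _; congr (_ * _).
    by rewrite mxE; apply: eq_bigr => l _; rewrite mxE.
  apply: le_trans (ler_norm_sum _ _ _) _; rewrite mulr_suml; apply: ler_sum => r _.
  rewrite normrM ler_wpM2l//.
  rewrite (_ : \sum_l _ = y r - \sum_l (f l (x r) - f l (u r)) * c l 0); last first.
    by rewrite -sumrB; apply: eq_bigr => l _; rewrite -mulrBl opprB addrC subrK.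
  apply: le_trans (ler_normB _ _) _; apply: lerD.
    by rewrite /Y (bigD1 r)//= lerDl sumr_ge0.
  apply: le_trans (ler_norm_sum _ _ _) _; rewrite mulr_sumr; apply: ler_sum => l _.
  by rewrite normrM ler_wpM2r.
have SY : S <= 2 * b * Y.
  have : S <= b * (Y + eps * S).
    apply: (@le_trans _ _ (\sum_k (\sum_r `|W k r|) * (Y + eps * S))).
      exact: ler_sum.
    rewrite -mulr_suml ler_wpM2r ?lerDr// addr_ge0// mulr_ge0// ltW//.
  have -> : b * (Y + eps * S) = b * Y + S / 2.
    by rewrite /eps; field; rewrite gt_eqF.
  lra.
rewrite ler_pdivrMl; last by rewrite !mulr_gt0 ?exprn_gt0.
apply: (@le_trans _ _ (S ^+ 2)).
  rewrite (_ : S ^+ 2 = \sum_k `|c k 0| * S); last by rewrite -mulr_suml expr2.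
  apply: ler_sum => k _.
  rewrite -real_normK ?num_real// expr2 ler_wpM2l//.
  by rewrite /S (bigD1 k)//= lerDl sumr_ge0.
apply: (@le_trans _ _ ((2 * b * Y) ^+ 2)).
  by rewrite lerXn2r ?nnegrE// !mulr_ge0// ltW.
rewrite (_ : (2 * b * Y) ^+ 2 = 4 * b ^+ 2 * Y ^+ 2); last by ring.
rewrite -[X in _ <= X]mulrA ler_wpM2l//; first by rewrite mulr_ge0// sqr_ge0.
apply: le_trans (sqr_sum_le _) _; rewrite ler_wpM2r ?ler_nat//.
by rewrite sumr_ge0// => r _; rewrite sqr_ge0.
Qed.

End unisolvent_boxes.

Lemma poly_basis_free (R : realType) d l q (psi : 'I_q -> mpoly d R) :
  poly_basis l psi -> forall c : 'I_q -> R, \sum_k c k *: psi k = 0 ->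
  forall k, c k = 0.
Proof.
move=> [_ H] c c0 k.
have [|c' [_ uniq]] := H 0; first by rewrite msize0.
have e1 : c' = \row_k c k.
  by apply: uniq; rewrite -[LHS]c0; apply: eq_bigr => i _; rewrite mxE.
have e2 : c' = 0.
  by apply: uniq; rewrite big1// => i _; rewrite mxE scale0r.
by have /rowP/(_ k) := etrans (esym e1) e2; rewrite !mxE.
Qed.

(** * Finite product weights *)

Section product_sums.
Context (R : realType) (T : finType).

Definition prod_weight (I : finType) (w : I -> T -> R) (a : {ffun I -> T}) : R :=
  \prod_i w i (a i).

Lemma prod_weight_ge0 (I : finType) (w : I -> T -> R) a :
  (forall i x, 0 <= w i x) -> 0 <= prod_weight w a.
Proof. by move=> w0; rewrite prodr_ge0. Qed.

Lemma sum_prod_weight (I : finType) (w : I -> T -> R) :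
  \sum_a prod_weight w a = \prod_i \sum_x w i x.
Proof. by rewrite bigA_distr_bigA. Qed.

Lemma sum_prod_weight_in (I : finType) (w : I -> T -> R) (E : I -> {set T}) :
  \sum_a prod_weight w a * [forall i, a i \in E i]%:R =
  \prod_i \sum_(x in E i) w i x.
Proof.
under [RHS]eq_bigr do rewrite big_mkcond/=.
rewrite bigA_distr_bigA; apply: eq_bigr => a _.
case: forallP => [h|/forallP]; first by rewrite mulr1; apply: eq_bigr => i _; rewrite h.
by rewrite negb_forall => /existsP[i ai]; rewrite mulr0 (bigD1 i)//= (negbTE ai) mul0r.
Qed.

(** Independence of functions of disjoint sets of coordinates, for weights that
    need not sum to 1.  In the double sum over [(a, b)], exchanging the
    coordinates of [a] and [b] outside [A] preserves the product of the weights
    and turns [f a * g b] into [f a * g a]. *)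
Lemma prod_weight_indep (I : finType) (w : I -> T -> R) (A : {set I})
    (f g : {ffun I -> T} -> R) :
  (forall a b : {ffun I -> T}, {in A, a =1 b} -> f a = f b) ->
  (forall a b : {ffun I -> T}, {in ~: A, a =1 b} -> g a = g b) ->
  (\sum_a prod_weight w a * (f a * g a)) * (\sum_a prod_weight w a) =
  (\sum_a prod_weight w a * f a) * (\sum_a prod_weight w a * g a).
Proof.
move=> fA gA; rewrite !big_distrlr/= !pair_big/=.
pose mix (a b : {ffun I -> T}) := [ffun i => if i \in A then a i else b i].
pose h (ab : {ffun I -> T} * {ffun I -> T}) := (mix ab.1 ab.2, mix ab.2 ab.1).
have hK : involutive h.
  move=> [a b]; rewrite /h /=; congr pair; apply/ffunP => i; rewrite !ffunE.
    by case: (i \in A).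
  by case: (i \in A).
rewrite [RHS](reindex h)/=; last by exists h => ab _; rewrite hK.
apply: eq_bigr => -[a b] _ /=.
have -> : f (mix a b) = f a by apply: fA => i iA; rewrite ffunE iA.
have -> : g (mix b a) = g a.
  by apply: gA => i; rewrite inE => iA; rewrite ffunE (negbTE iA).
have -> : prod_weight w (mix a b) * f a * (prod_weight w (mix b a) * g a) =
  (prod_weight w (mix a b) * prod_weight w (mix b a)) * (f a * g a) by ring.
rewrite [LHS]mulrAC; congr (_ * _); rewrite -!big_split/=; apply: eq_bigr => i _.
by rewrite !ffunE; case: ifP => // _; rewrite mulrC.
Qed.

(** Working with unnormalized weights avoids conditioning on events of
    probability zero: if the total weight vanishes, both sides do. *)
Lemma prod_weight_indep_le (I J : finType) (w : I -> T -> R) (A : J -> {set I})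
    (F : J -> {ffun I -> T} -> R) (theta : R) (s : seq J) :
  (forall i x, 0 <= w i x) -> 0 <= theta ->
  (forall j a, 0 <= F j a) ->
  (forall j (a b : {ffun I -> T}), {in A j, a =1 b} -> F j a = F j b) ->
  (forall i j k, i \in A j -> i \in A k -> j = k) -> uniq s ->
  (forall j, j \in s -> \sum_a prod_weight w a * F j a <= theta * \sum_a prod_weight w a) ->
  \sum_a prod_weight w a * \prod_(j <- s) F j a
    <= theta ^+ size s * \sum_a prod_weight w a.
Proof.
move=> w0 th0 F0 FA Adisj; elim: s => [_ _|j s IH /= /andP[js us] Hs].
  rewrite expr0 mul1r; apply: ler_sum => a _.
  by rewrite big_nil mulr1.
set W := \sum_a _ in IH Hs *; have W0 : 0 <= W.
  by rewrite sumr_ge0// => a _; rewrite prod_weight_ge0.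
have {}IH : \sum_a prod_weight w a * \prod_(j0 <- s) F j0 a <= theta ^+ size s * W.
  by apply: IH => // k ks; apply: Hs; rewrite inE ks orbT.
have Hj := Hs j (mem_head _ _).
under eq_bigr do rewrite big_cons.
have E : (\sum_a prod_weight w a * (F j a * \prod_(j0 <- s) F j0 a)) * W =
    (\sum_a prod_weight w a * F j a) * (\sum_a prod_weight w a * \prod_(j0 <- s) F j0 a).
  apply: (prod_weight_indep w (FA j)) => a b ab; rewrite !big_seq.
  apply: eq_bigr => k ks; apply: FA => i ik; apply: ab; rewrite inE.
  by apply: contraNN js => ij; rewrite (Adisj _ _ _ ij ik).
have [W00|Wn0] := eqVneq W 0.
  rewrite W00 mulr0; suff -> : forall f, \sum_a prod_weight w a * f a = 0 by [].
  move=> f; apply: big1 => a _; have /eqP := W00.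
  rewrite psumr_eq0; last by move=> b _; rewrite prod_weight_ge0.
  by move=> /allP/(_ a (mem_index_enum _)) /eqP ->; rewrite mul0r.
have Wgt0 : 0 < W by rewrite lt_def Wn0.
rewrite -(ler_pM2r Wgt0) E exprS.
apply: le_trans (ler_pM _ _ Hj IH) _; last by rewrite -!mulrA ler_wpM2l// mulrCA.
  by rewrite sumr_ge0// => a _; rewrite mulr_ge0// prod_weight_ge0.
by rewrite sumr_ge0// => a _; rewrite mulr_ge0// ?prod_weight_ge0// prodr_ge0.
Qed.

End product_sums.

(** From [exp (- u / 2) >= 1 - u / 2], by squaring and inverting. *)
Lemma expR_le_quad (R : realType) (u : R) : `|u| <= 3^-1 -> expR u <= 1 + u + u ^+ 2.
Proof.
rewrite ler_norml => /andP[u1 u2].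
have h : 1 - u / 2 <= expR (- (u / 2)) by exact: expR_ge1Dx.
have p : 0 < 1 - u / 2 by lra.
have -> : expR u = (expR (- (u / 2))) ^- 2.
  by rewrite -exprVn expRN invrK expr2 -expRD; congr expR; field.
apply: (@le_trans _ _ ((1 - u / 2) ^- 2)).
  by rewrite lef_pV2 ?posrE ?exprn_gt0 ?expR_gt0// lerXn2r ?nnegrE ?expR_ge0// ltW.
rewrite invf_ple ?posrE ?exprn_gt0//; last by nra.
rewrite -[leLHS]mul1r ler_pdivrMr; last by nra.
have -> : (1 - u / 2) ^+ 2 * (1 + u + u ^+ 2) =
  1 + u ^+ 2 * ((1 - 3 * u + u ^+ 2) / 4) by field.
by rewrite lerDl mulr_ge0 ?sqr_ge0// divr_ge0//; have := sqr_ge0 u; lra.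
Qed.

Section bounded_differences.
Context (R : realType) (T : finType).

Definition ffun_cons n (x : T) (b : {ffun 'I_n -> T}) : {ffun 'I_n.+1 -> T} :=
  [ffun i => if unlift ord0 i is Some k then b k else x].

Lemma ffun_cons0 n x (b : {ffun 'I_n -> T}) : ffun_cons x b ord0 = x.
Proof. by rewrite ffunE unlift_none. Qed.

Lemma ffun_consS n x (b : {ffun 'I_n -> T}) i : ffun_cons x b (lift ord0 i) = b i.
Proof. by rewrite ffunE liftK. Qed.

Lemma sum_ffun_cons n (F : {ffun 'I_n.+1 -> T} -> R) :
  \sum_a F a = \sum_x \sum_b F (ffun_cons x b).
Proof.
rewrite pair_big/= (reindex (fun xb => ffun_cons xb.1 xb.2))//=.
exists (fun a => (a ord0, [ffun i => a (lift ord0 i)])) => [[x b] _|a _] /=.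
  congr pair; first by rewrite ffun_cons0.
  by apply/ffunP => i; rewrite !ffunE liftK.
by apply/ffunP => i; rewrite ffunE; case: unliftP => [j|] ->; rewrite ?ffunE.
Qed.

Lemma prod_weight_cons n (w : 'I_n.+1 -> T -> R) x b :
  prod_weight w (ffun_cons x b) = w ord0 x * prod_weight (fun i => w (lift ord0 i)) b.
Proof.
rewrite /prod_weight big_ord_recl ffun_cons0; congr (_ * _).
by apply: eq_bigr => i _; rewrite ffun_consS.
Qed.

(** One coordinate is integrated at a time: given the others, the function
    oscillates by at most [c] around its mean, so the first order term of the
    exponential cancels and the second order term costs [(s * c) ^ 2]. *)
Lemma bounded_differences_mgf n (w : 'I_n -> T -> R) (f : {ffun 'I_n -> T} -> R)
    (c s : R) :
  (forall i x, 0 <= w i x) -> (forall i, \sum_x w i x = 1) ->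
  (forall i (a b : {ffun 'I_n -> T}), (forall j, j != i -> a j = b j) ->
     `|f a - f b| <= c) ->
  0 <= s -> s * c <= 3^-1 ->
  \sum_a prod_weight w a * expR (- (s * f a)) <=
  expR (- (s * \sum_a prod_weight w a * f a) + n%:R * (s * c) ^+ 2).
Proof.
move=> + + + s0 sc; elim: n w f => [|n IH] w f w0 w1 fc.
  pose a0 : {ffun 'I_0 -> T} := ffun0 (card_ord 0).
  have E (F : {ffun 'I_0 -> T} -> R) : \sum_a prod_weight w a * F a = F a0.
    rewrite (big_pred1 a0) ?/prod_weight ?big_ord0 ?mul1r// => a.
    by apply/esym/eqP/ffunP => -[].
  by rewrite !E mul0r addr0.
pose w' i := w (lift ord0 i).
pose g x := \sum_b prod_weight w' b * f (ffun_cons x b).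
have w'1 : \sum_b prod_weight w' b = 1.
  by rewrite sum_prod_weight big1// => i _; exact: w1.
have gE : \sum_a prod_weight w a * f a = \sum_x w ord0 x * g x.
  rewrite sum_ffun_cons; apply: eq_bigr => x _; rewrite mulr_sumr.
  by apply: eq_bigr => b _; rewrite prod_weight_cons mulrA.
set mean := \sum_a _ in gE *.
have gg x y : `|g x - g y| <= c.
  rewrite -sumrB -[c]mul1r -w'1 mulr_suml; apply: le_trans (ler_norm_sum _ _ _) _.
  apply: ler_sum => b _; rewrite -mulrBr normrM ger0_norm; last first.
    by rewrite prod_weight_ge0// => i z; exact: w0.
  rewrite ler_wpM2l//; first by rewrite prod_weight_ge0// => i z; exact: w0.
  apply: (fc ord0) => j j0; case: (unliftP ord0 j) => [k ->|jE].
    by rewrite !ffun_consS.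
  by rewrite jE eqxx in j0.
have gm x : `|g x - mean| <= c.
  rewrite gE -[g x]mul1r -(w1 ord0) mulr_suml -sumrB -[c]mul1r -(w1 ord0) mulr_suml.
  apply: le_trans (ler_norm_sum _ _ _) _; apply: ler_sum => y _.
  by rewrite -mulrBr normrM ger0_norm// ler_wpM2l.
have step x : \sum_b prod_weight w' b * expR (- (s * f (ffun_cons x b))) <=
    expR (- (s * g x) + n%:R * (s * c) ^+ 2).
  apply: IH => [i y|i|i a b ab]; [exact: w0|exact: w1|apply: (fc (lift ord0 i))].
  move=> j ji; case: (unliftP ord0 j) => [k jE|->]; last by rewrite !ffun_cons0.
  by rewrite jE !ffun_consS ab//; apply: contraNneq ji => <-; rewrite jE.
rewrite sum_ffun_cons.
apply: (@le_trans _ _ (\sum_x w ord0 x *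
    (expR (- (s * mean) + n%:R * (s * c) ^+ 2) * expR (- (s * (g x - mean)))))).
  apply: ler_sum => x _; under eq_bigr do rewrite prod_weight_cons -mulrA.
  rewrite -mulr_sumr ler_wpM2l//; apply: le_trans (step x) _.
  by rewrite -expRD ler_expR; lra.
apply: (@le_trans _ _ (\sum_x w ord0 x *
    (expR (- (s * mean) + n%:R * (s * c) ^+ 2) * (1 - s * (g x - mean) + (s * c) ^+ 2)))).
  apply: ler_sum => x _; rewrite ler_wpM2l// ler_wpM2l ?expR_ge0//.
  have sg : `|- (s * (g x - mean))| <= s * c.
    by rewrite normrN normrM ger0_norm// ler_wpM2l.
  apply: le_trans (expR_le_quad (le_trans sg sc)) _.
  rewrite lerD2l -real_normK ?num_real// lerXn2r ?nnegrE//.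
  by apply: le_trans sg.
under eq_bigr do rewrite mulrCA.
rewrite -mulr_sumr.
have -> : \sum_x w ord0 x * (1 - s * (g x - mean) + (s * c) ^+ 2) = 1 + (s * c) ^+ 2.
  under eq_bigr => x _.
    rewrite (_ : _ * _ = w ord0 x * (1 + s * mean + (s * c) ^+ 2) - s * (w ord0 x * g x)); last by ring.
    over.
  by rewrite sumrB -mulr_suml -mulr_sumr -gE w1; ring.
rewrite -natr1 mulrDl mul1r addrA [leRHS]expRD ler_wpM2l ?expR_ge0//.
exact: expR_ge1Dx.
Qed.

End bounded_differences.

(** * Occupancy of cells by independent labelled points *)

Lemma prod_enum_index (R : comNzRingType) (I : finType) (A : {set I}) (F : nat -> R) :
  \prod_(i in A) F (index i (enum A)) = \prod_(r < #|A|) F r.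
Proof.
rewrite big_enum_val; apply: eq_bigr => r _.
by rewrite (enum_val_nth (enum_default r)) index_uniq// ?enum_uniq// -cardE.
Qed.

Section occupancy.
Context (R : realType) (C L K : finType) (n m : nat).

Definition cell_of (a : {ffun 'I_n -> option C}) (Q : C) : {set 'I_n} :=
  finset (fun i => a i == Some Q).

(** The index of a point in the enumeration of its cell is the role that it
    has to play in the pattern [k]. *)
Definition matches (D : K -> nat -> {set L}) (A : {set 'I_n}) (l : {ffun 'I_n -> L}) :=
  [exists k, [forall i, (i \in A) ==> (l i \in D k (index i (enum A)))]].

Definition full_cells (a : {ffun 'I_n -> option C}) : {set C} :=
  finset (fun Q => #|cell_of a Q| == m).

Definition hit_cells D a l : {set C} :=
  finset (fun Q => (Q \in full_cells a) && matches D (cell_of a Q) l).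

Context (D : K -> nat -> {set L}).
Hypothesis D_disj : forall k k' x, x \in D k 0 -> x \in D k' 0 -> k = k'.

Context (p : option C -> L -> R) (theta : nat -> R).
Hypothesis p_ge0 : forall c x, 0 <= p c x.
Hypothesis theta_ge0 : forall r, 0 <= theta r.
Hypothesis p_D : forall Q k r, (r < m)%N ->
  theta r * \sum_x p (Some Q) x <= \sum_(x in D k r) p (Some Q) x.
Hypothesis m_gt0 : (0 < m)%N.

Let w (a : {ffun 'I_n -> option C}) (i : 'I_n) := p (a i).

Let w_ge0 a l : 0 <= prod_weight (w a) l.
Proof. by apply: prod_weight_ge0 => i x; exact: p_ge0. Qed.

(** By [D_disj] at most one pattern is realized by a given assignment, so the
    probabilities of the patterns add up. *)
Lemma sum_matches (a : {ffun 'I_n -> option C}) Q : Q \in full_cells a ->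
  #|K|%:R * \prod_(r < m) theta r * \sum_l prod_weight (w a) l <=
  \sum_l prod_weight (w a) l * (matches D (cell_of a Q) l)%:R.
Proof.
rewrite inE => /eqP Qm; set A := cell_of a Q in Qm *.
pose E k i : {set L} := if i \in A then D k (index i (enum A)) else [set: L]%SET.
have matchE l : (matches D A l)%:R = \sum_k [forall i, l i \in E k i]%:R :> R.
  have EE k : [forall i, (i \in A) ==> (l i \in D k (index i (enum A)))] =
              [forall i, l i \in E k i].
    by apply: eq_forallb => i; rewrite /E; case: (i \in A) => //=; rewrite inE.
  rewrite /matches; under eq_existsb do rewrite EE.
  have [/existsP[k hk]|/existsPn no] := boolP [exists k, [forall i, l i \in E k i]]; last first.
    by rewrite big1// => k _; rewrite (negbTE (no k)).
  rewrite (bigD1 k)//= hk big1 ?addr0// => k' k'k.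
  case: forallP => // hk'; case/eqP: k'k.
  have [i0 i0A] : exists i0, index i0 (enum A) = 0%N /\ i0 \in A.
    have : (0 < size (enum A))%N by rewrite -cardE Qm.
    case E0: (enum A) => [//|i0 s] _; exists i0; rewrite /= eqxx; split => //.
    by rewrite -mem_enum E0 mem_head.
  move: i0A => [i00 i0A].
  have := hk' i0; have /forallP/(_ i0) := hk; rewrite /E i0A i00.
  by move=> h1 h2; apply: D_disj h2 h1.
under [leRHS]eq_bigr do rewrite matchE mulr_sumr.
rewrite exchange_big/= -mulrA.
rewrite (_ : #|K|%:R * ?[X] = \sum_(k : K) ?X); last by rewrite sumr_const mulr_natl.
apply: ler_sum => k _.
rewrite sum_prod_weight_in sum_prod_weight.
rewrite -Qm -(prod_enum_index A theta) big_mkcond/= -big_split/=.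
apply: ler_prod => i _; apply/andP; split.
  apply: mulr_ge0; first by case: ifP.
  by apply: sumr_ge0 => x _; exact: p_ge0.
rewrite /E; case: ifPn => iA; last first.
  by rewrite mul1r [leRHS](eq_bigl xpredT)// => x; rewrite inE.
have := iA; rewrite inE => /eqP ai; rewrite /w ai p_D//.
by rewrite -Qm cardE index_mem mem_enum.
Qed.

(** Conditionally on the cells [a] of the points, each full cell contributes
    a factor [exp (-1) <= 1 / 2] with conditional probability at least
    [delta], hence a factor at most [1 - delta / 2] on average. *)
Lemma sum_hits (a : {ffun 'I_n -> option C}) (delta : R) :
  0 <= delta <= 1 -> delta <= #|K|%:R * \prod_(r < m) theta r ->
  \sum_l prod_weight (w a) l * expR (- #|hit_cells D a l|%:R) <=
  expR (- (delta / 2 * #|full_cells a|%:R)) * \sum_l prod_weight (w a) l.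
Proof.
move=> /andP[d0 d1] dK.
pose F Q l : R := if matches D (cell_of a Q) l then expR (-1) else 1.
have e2 : expR (-1) <= 2^-1 :> R.
  rewrite expRN lef_pV2 ?posrE ?expR_gt0//; exact: (@expR_ge1Dx R 1).
have FE l : expR (- #|hit_cells D a l|%:R) = \prod_(Q <- enum (full_cells a)) F Q l.
  rewrite big_enum/= -big_mkcondr/= prodr_const -expRM_natl mulrN1; congr (expR (- _%:R)).
  by rewrite cardsE.
under eq_bigr do rewrite FE.
have th0 : 0 <= 1 - delta / 2 by lra.
apply: (@le_trans _ _ ((1 - delta / 2) ^+ #|full_cells a| * \sum_l prod_weight (w a) l)).
  rewrite [X in _ ^+ X]cardE.
  apply: (prod_weight_indep_le (A := cell_of a)) => //.
  - by move=> i x; exact: p_ge0.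
  - by move=> Q l; rewrite /F; case: ifP => // _; exact: expR_ge0.
  - move=> Q l l' ll'; rewrite /F (_ : matches D _ l = matches D (cell_of a Q) l')//.
    apply: eq_existsb => k; apply: eq_forallb => i.
    by case: (boolP (i \in _)) => //= iA; rewrite ll'.
  - by move=> i Q Q'; rewrite !inE => /eqP -> /eqP[].
  - exact: enum_uniq.
  move=> Q; rewrite mem_enum => Qf; have Hm := sum_matches Qf.
  set W := \sum_l _ in Hm *; have W0 : 0 <= W.
    by apply: sumr_ge0 => l _; exact: w_ge0.
  apply: (@le_trans _ _ (\sum_l (prod_weight (w a) l -
       2^-1 * (prod_weight (w a) l * (matches D (cell_of a Q) l)%:R)))).
    apply: ler_sum => l _; rewrite /F; case: ifP => _; last by rewrite !mulr0 subr0 mulr1.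
    have w0 := w_ge0 a l.
    apply: (@le_trans _ _ (prod_weight (w a) l * 2^-1)); first by rewrite ler_wpM2l.
    by rewrite mulr1; lra.
  rewrite sumrB -mulr_sumr -/W mulrBl mul1r lerD2l lerN2 [leLHS]mulrAC mulrC ler_wpM2l//.
  by apply: le_trans Hm; rewrite ler_wpM2r.
rewrite ler_wpM2r//; first by apply: sumr_ge0 => l _; exact: w_ge0.
rewrite -[X in expR X]mulNr expRM_natr lerXn2r ?nnegrE ?expR_ge0//.
exact: expR_ge1Dx.
Qed.

End occupancy.

Section counting.
Context (R : realType) (C : finType) (n m : nat) (p : option C -> R).
Hypothesis p_ge0 : forall c, 0 <= p c.
Hypothesis p_sum : \sum_c p c = 1.

Let w (i : 'I_n) (c : option C) := p c.

(** Only the cells of [a i] and [b i] can change status. *)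
Lemma full_cells_bounded (i : 'I_n) (a b : {ffun 'I_n -> option C}) :
  (forall j, j != i -> a j = b j) ->
  `|#|full_cells m a|%:R - #|full_cells m b|%:R| <= 2 :> R.
Proof.
move=> ab.
have half (a' b' : {ffun 'I_n -> option C}) : (forall j, j != i -> a' j = b' j) ->
    (#|full_cells m a'| <= #|full_cells m b'| + 2)%N.
  move=> ab'; pose S : {set C} := finset (fun Q => (a' i == Some Q) || (b' i == Some Q)).
  have sub : full_cells m a' \subset full_cells m b' :|: S.
    apply/fintype.subsetP => Q; rewrite !inE => /eqP QE.
    have [Sa|Sa] := boolP (a' i == Some Q); first by rewrite orbT.
    have [Sb|Sb] := boolP (b' i == Some Q); first by rewrite !orbT.
    rewrite /= orbF -QE; apply/eqP/eq_card => j; rewrite !inE.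
    by have [->|/ab' ->//] := eqVneq j i; rewrite (negbTE Sa) (negbTE Sb).
  apply: leq_trans (subset_leq_card sub) _; apply: leq_trans (leq_card_setU _ _).1 _.
  rewrite leq_add2l.
  have single (o : option C) : (#|finset (fun Q => o == Some Q)| <= 1)%N.
    case: o => [Q0|].
      rewrite -(cards1 Q0) subset_leq_card//; apply/fintype.subsetP => Q.
      by rewrite !inE => /eqP[->].
    by rewrite (_ : finset _ = finset.set0) ?cards0//; apply/setP => Q; rewrite !inE.
  have -> : S = finset (fun Q => a' i == Some Q) :|: finset (fun Q => b' i == Some Q).
    by apply/setP => Q; rewrite !inE.
  by apply: leq_trans (leq_card_setU _ _).1 _; exact: leq_add (single _) (single _).
have h1 := half a b ab.
have h2 : (#|full_cells m b| <= #|full_cells m a| + 2)%N.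
  by apply: half => j ji; rewrite ab.
rewrite ler_norml; move: h1 h2; rewrite -!(ler_nat R) !natrD => h1 h2.
by apply/andP; split; lra.
Qed.

Lemma prob_cell_of (Q : C) (S : {set 'I_n}) :
  \sum_a prod_weight w a * (cell_of a Q == S)%:R =
  p (Some Q) ^+ #|S| * (1 - p (Some Q)) ^+ (n - #|S|).
Proof.
pose E i : {set option C} := if i \in S then [set Some Q]%SET else (~: [set Some Q])%SET.
have cE a : (cell_of a Q == S) = [forall i, a i \in E i].
  apply/eqP/forallP => [aS i|h].
    by rewrite /E -aS !inE; case: ifPn => ai; rewrite !inE.
  apply/setP => i; have := h i; rewrite /E inE; case: ifP => _; rewrite !inE//.
  by move/negbTE.
under eq_bigr do rewrite cE.
rewrite sum_prod_weight_in (bigID (mem S))/=; congr (_ * _).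
  rewrite -prodr_const; apply: eq_bigr => i iS.
  by rewrite /E iS big_set1.
have -> : (n - #|S| = #|~: S|)%N by rewrite [RHS]cardsCs finset.setCK card_ord.
rewrite -prodr_const; apply: eq_big => [i|i iS]; first by rewrite !inE.
have -> : 1 - p (Some Q) = \sum_(c | c != Some Q) p c.
  by rewrite -p_sum (bigD1 (Some Q))//= addrAC subrr add0r.
rewrite /E (negbTE iS).
by apply: eq_bigl => c; rewrite !inE.
Qed.

Lemma mean_full_cells :
  \sum_a prod_weight w a * #|full_cells m a|%:R =
  \sum_Q p (Some Q) ^+ m * (1 - p (Some Q)) ^+ (n - m) *+ 'C(n, m).
Proof.
have E a : #|full_cells m a|%:R =
    \sum_Q \sum_(S : {set 'I_n} | #|S| == m) (cell_of a Q == S)%:R :> R.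
  rewrite -sum1_card natr_sum big_mkcond/=; apply: eq_bigr => Q _; rewrite inE.
  case: ifP => [Qm|Qm].
    rewrite (bigD1 (cell_of a Q))//= eqxx big1 ?addr0// => S /andP[_ /negbTE].
    by rewrite eq_sym => ->.
  by rewrite big1// => S /eqP Sm; case: eqP => // QS; rewrite QS Sm eqxx in Qm.
under eq_bigr do rewrite E mulr_sumr.
rewrite exchange_big/=; apply: eq_bigr => Q _.
under eq_bigr do rewrite mulr_sumr.
rewrite exchange_big/=.
have -> : 'C(n, m) = #|finset (fun S : {set 'I_n} => #|S| == m)|.
  by rewrite card_draws card_ord.
rewrite -sumr_const; apply: eq_big => [S|S /eqP Sm]; first by rewrite inE.
by rewrite prob_cell_of Sm.
Qed.

End counting.

(** Markov's inequality applied to [exp (- hits)].  After averaging over the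
    labels, the exponent is [- delta / 2] times the number of full cells, a
    function of the cells of the points with differences bounded by 2. *)
Lemma occupancy_tail (R : realType) (C L K : finType) (n m : nat)
    (D : K -> nat -> {set L}) (p : option C -> L -> R) (theta : nat -> R)
    (delta mu x : R) :
  (forall k k' l, l \in D k 0 -> l \in D k' 0 -> k = k') ->
  (forall c l, 0 <= p c l) -> \sum_c \sum_l p c l = 1 ->
  (forall r, 0 <= theta r) ->
  (forall Q k r, (r < m)%N ->
    theta r * \sum_l p (Some Q) l <= \sum_(l in D k r) p (Some Q) l) ->
  (0 < m)%N -> 0 <= delta <= 3^-1 ->
  delta <= #|K|%:R * \prod_(r < m) theta r ->
  (mu <= \sum_Q (\sum_l p (Some Q) l) ^+ m * (1 - \sum_l p (Some Q) l) ^+ (n - m) *+ 'C(n, m)) ->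
  \sum_(a : {ffun 'I_n -> option C}) \sum_(l : {ffun 'I_n -> L})
     (\prod_i p (a i) (l i)) * (#|hit_cells m D a l|%:R < x)%R%:R <=
  expR (x - delta / 2 * mu + n%:R * delta ^+ 2).
Proof.
move=> D_disj p0 p1 th0 pD m0 /andP[d0 d3] dK muE.
pose pc c := \sum_l p c l.
have pc0 c : 0 <= pc c by rewrite sumr_ge0.
apply: (@le_trans _ _ (\sum_(a : {ffun 'I_n -> option C})
    expR x * (prod_weight (fun=> pc) a * expR (- (delta / 2 * #|full_cells m a|%:R))))).
  apply: ler_sum => a _.
  apply: (@le_trans _ _ (expR x * \sum_l prod_weight (fun i => p (a i)) l *
      expR (- #|hit_cells m D a l|%:R))).
    rewrite mulr_sumr; apply: ler_sum => l _; rewrite mulrCA ler_wpM2l ?prodr_ge0//.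
    rewrite -expRD; case: ltP => h; last by rewrite expR_ge0.
    by rewrite -[leLHS]expR0 ler_expR; lra.
  rewrite ler_wpM2l ?expR_ge0// mulrC.
  have -> : prod_weight (fun=> pc) a = \sum_l prod_weight (fun i => p (a i)) l.
    by rewrite sum_prod_weight.
  apply: (sum_hits D_disj p0 th0 pD m0 _ _ dK).
  by rewrite d0/=; lra.
rewrite -mulr_sumr -addrA expRD ler_wpM2l ?expR_ge0//.
have H := @bounded_differences_mgf R (option C) n (fun=> pc)
  (fun a => #|full_cells m a|%:R) 2 (delta / 2).
apply: le_trans (H _ _ _ _ _) _ => //.
- by move=> i a b ab; exact: full_cells_bounded ab.
- by rewrite divr_ge0.
- by rewrite divfK.
rewrite ler_expR divfK// lerD2r lerN2 ler_wpM2l ?divr_ge0//.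
by rewrite mean_full_cells.
Qed.

Lemma ffact_ge n m : (2 * m <= n)%N -> (n ^ m <= 2 ^ m * n ^_ m)%N.
Proof.
elim: m => // m IH mn; rewrite ffactnSr expnSr [X in (_ <= X * _)%N]expnSr.
rewrite mulnACA leq_mul//; first by apply: IH; lia.
by lia.
Qed.

(** Lower bound of Poisson type, uniform in [n], for a success probability
    between [a / n] and [b / n]. *)
Lemma binomial_pmf_ge (R : realType) (a b : R) (m n : nat) (p : R) :
  0 <= a -> (2 * m <= n)%N -> (0 < n)%N -> 2 * b <= n%:R ->
  a / n%:R <= p -> p <= b / n%:R ->
  (a / 2) ^+ m / m`!%:R * expR (- (2 * b)) <=
  p ^+ m * (1 - p) ^+ (n - m) *+ 'C(n, m).
Proof.
move=> a0 mn n0 bn ap pb.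
have nR : (0 : R) < n%:R by rewrite ltr0n.
have p2 : p <= 2^-1.
  by apply: le_trans pb _; rewrite ler_pdivrMr//; lra.
have p0 : 0 <= p by apply: le_trans ap; rewrite divr_ge0// ltW.
have h1 : expR (- (2 * b)) <= (1 - p) ^+ (n - m).
  have e : expR (- (2 * p)) <= 1 - p.
    have : 1 + 2 * p <= expR (2 * p) by exact: expR_ge1Dx.
    move=> e; rewrite expRN invf_ple ?posrE ?expR_gt0//; last by lra.
    apply: le_trans e; rewrite -[leLHS]mul1r ler_pdivrMr; last by lra.
    by nra.
  apply: (@le_trans _ _ ((1 - p) ^+ n)); last first.
    by rewrite ler_wiXn2l ?leq_subr//; lra.
  apply: (@le_trans _ _ (expR (- (2 * p)) ^+ n)); last first.
    by rewrite lerXn2r ?nnegrE ?expR_ge0//; lra.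
  rewrite -expRM_natl ler_expR; move: pb; rewrite ler_pdivlMr//; lra.
rewrite -[leRHS]mulr_natr [leRHS]mulrAC; apply: ler_pM => //.
  by rewrite divr_ge0// exprn_ge0// divr_ge0.
rewrite ler_pdivrMr ?ltr0n ?fact_gt0// -mulrA -natrM bin_ffact.
apply: (@le_trans _ _ ((a / n%:R) ^+ m * (n ^_ m)%:R)); last first.
  by rewrite ler_wpM2r// lerXn2r ?nnegrE// divr_ge0// ltW.
rewrite !expr_div_n -!mulrA ler_wpM2l ?exprn_ge0//.
rewrite ler_pdivlMl ?exprn_gt0// ler_pdivrMr ?exprn_gt0//.
by rewrite -!natrX -natrM ler_nat mulnC ffact_ge.
Qed.

(** * Measurability of the good cell events *)

Section finite_valued.
Context (d : measure_display) (Omega : measurableType d).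

Definition fin_measurable (T : finType) (f : Omega -> T) :=
  forall v, measurable [set w | f w = v].

Lemma fin_measurable_pred (T : finType) (f : Omega -> T) (A : pred T) :
  fin_measurable f -> measurable [set w | A (f w)].
Proof.
move=> mf; rewrite (_ : [set w | _] = \bigcup_(v in [set v | A v]) [set w | f w = v]).
  by apply: fin_bigcup_measurable => // v _; exact: mf.
by apply/seteqP; split=> [w /= Aw|w [v /= Av fw]]; [exists (f w)|rewrite fw].
Qed.

Lemma fin_measurable_comp (T T' : finType) (f : Omega -> T) (g : T -> T') :
  fin_measurable f -> fin_measurable (fun w => g (f w)).
Proof.
move=> mf v; rewrite (_ : [set w | _] = [set w | g (f w) == v]).
  exact: (fin_measurable_pred (fun x => g x == v)).
by apply/seteqP; split=> w /= /eqP.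
Qed.

Lemma fin_measurable_cst (T : finType) (x : T) : fin_measurable (fun=> x).
Proof.
move=> v; have [->|xv] := eqVneq x v.
  by rewrite (_ : [set w | _] = setT)//; apply/seteqP; split.
rewrite (_ : [set w | _] = set0)//; apply/seteqP; split => // w /= /eqP.
by rewrite (negbTE xv).
Qed.

Lemma fin_measurable_bool (b : Omega -> bool) :
  measurable [set w | b w] -> fin_measurable b.
Proof.
move=> mb [].
  by rewrite (_ : [set w | _] = [set w | b w]).
rewrite (_ : [set w | _] = ~` [set w | b w]); first exact: measurableC.
by apply/seteqP; split=> w /=; [move=> -> //|move/negP/negbTE].
Qed.

Lemma fin_measurable_fun_bool (b : Omega -> bool) :
  measurable_fun setT b -> fin_measurable b.
Proof.
move=> mb v; have := mb measurableT [set v] I; rewrite setTI.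
by [].
Qed.

Lemma fin_measurable_pair (T T' : finType) (f : Omega -> T) (g : Omega -> T') :
  fin_measurable f -> fin_measurable g -> fin_measurable (fun w => (f w, g w)).
Proof.
move=> mf mg [v v'].
rewrite (_ : [set w | _] = [set w | f w = v] `&` [set w | g w = v']).
  by apply: measurableI; [exact: mf|exact: mg].
by apply/seteqP; split=> w /= [-> ->].
Qed.

Lemma fin_measurable_ffun (I T : finType) (f : I -> Omega -> T) :
  (forall i, fin_measurable (f i)) ->
  fin_measurable (fun w => [ffun i => f i w]).
Proof.
move=> mf v.
rewrite (_ : [set w | _] = \bigcap_(i in [set: I]) [set w | f i w = v i]).
  by apply: fin_bigcap_measurable => // i _; exact: mf.
apply/seteqP; split=> w /=; first by move=> <- i _ /=; rewrite ffunE.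
by move=> h; apply/ffunP => i; rewrite ffunE; exact: h.
Qed.

Lemma fin_measurable_forall (I : finType) (b : I -> Omega -> bool) :
  (forall i, fin_measurable (b i)) -> fin_measurable (fun w => [forall i, b i w]).
Proof.
move=> mb; rewrite (_ : (fun w => _) =
    fun w => [forall i, [ffun i => b i w] i]); last first.
  by apply/funext => w; apply: eq_forallb => i; rewrite ffunE.
apply: (fin_measurable_comp (fun v : {ffun I -> bool} => [forall i, v i])).
exact: fin_measurable_ffun.
Qed.

Lemma fin_measurable_set (I : finType) (b : I -> Omega -> bool) :
  (forall i, fin_measurable (b i)) ->
  fin_measurable (fun w => finset (fun i => b i w)).
Proof.
move=> mb; rewrite (_ : (fun w => _) =
    fun w => finset (fun i => [ffun i => b i w] i)); last first.
  by apply/funext => w; apply/setP => i; rewrite !inE ffunE.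
apply: (fin_measurable_comp (fun v : {ffun I -> bool} => finset (fun i => v i))).
exact: fin_measurable_ffun.
Qed.

Lemma fin_measurable_op2 (T1 T2 T' : finType) (op : T1 -> T2 -> T') f g :
  fin_measurable f -> fin_measurable g -> fin_measurable (fun w => op (f w) (g w)).
Proof.
move=> mf mg; exact: (fin_measurable_comp (fun x => op x.1 x.2)
  (fin_measurable_pair mf mg)).
Qed.

End finite_valued.

Section measurable_matrices.
Context (d : measure_display) (Omega : measurableType d) (R : realType).

(** On the reals [x^-1 = x * (x ^ 2)^-1], and the inverse of a nonnegative
    number is a real power. *)
Lemma measurable_inv : measurable_fun [set: R] (@GRing.inv R).
Proof.
rewrite (_ : @GRing.inv R = fun x => x * (x ^+ 2) `^ (-1)).
  apply: measurable_funM => //.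
  apply: (measurableT_comp (measurable_powR (-1))).
  exact: measurable_funX.
apply/funext => x; rewrite powR_inv1 ?sqr_ge0//.
have [->|x0] := eqVneq x 0; first by rewrite invr0 mul0r.
by rewrite expr2 invfM mulrA divff// mul1r.
Qed.

Definition mx_measurable m n (A : Omega -> 'M[R]_(m, n)) :=
  forall i j, measurable_fun setT (fun w => A w i j).

Lemma mx_measurable_cst m n (A : 'M[R]_(m, n)) : mx_measurable (fun=> A).
Proof. by move=> i j; exact: measurable_cst. Qed.

Lemma mx_measurable_mul m n p (A : Omega -> 'M[R]_(m, n)) (B : Omega -> 'M[R]_(n, p)) :
  mx_measurable A -> mx_measurable B -> mx_measurable (fun w => A w *m B w).
Proof.
move=> mA mB i j; under eq_fun do rewrite mxE.
by apply: measurable_sum => k; apply: measurable_funM.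
Qed.

Lemma mx_measurable_tr m n (A : Omega -> 'M[R]_(m, n)) :
  mx_measurable A -> mx_measurable (fun w => (A w)^T).
Proof. by move=> mA i j; under eq_fun do rewrite mxE; exact: mA. Qed.

Lemma mx_measurable_sub m n (A B : Omega -> 'M[R]_(m, n)) :
  mx_measurable A -> mx_measurable B -> mx_measurable (fun w => A w - B w).
Proof.
move=> mA mB i j; under eq_fun do rewrite 2!mxE.
exact: (measurable_funB (mA i j) (mB i j)).
Qed.

Lemma mx_measurable_scale m n (c : R) (A : Omega -> 'M[R]_(m, n)) :
  mx_measurable A -> mx_measurable (fun w => c *: A w).
Proof.
move=> mA i j; under eq_fun do rewrite mxE.
by apply: measurable_funM => //; exact: measurable_cst.
Qed.

Lemma measurable_det n (A : Omega -> 'M[R]_n) :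
  mx_measurable A -> measurable_fun setT (fun w => \det (A w)).
Proof.
move=> mA; apply: measurable_sum => s; apply: measurable_funM => //.
by apply: measurable_prod => i _; exact: mA.
Qed.

Lemma mx_measurable_inv n (A : Omega -> 'M[R]_n) :
  mx_measurable A -> mx_measurable (fun w => invmx (A w)).
Proof.
move=> mA i j.
rewrite (_ : (fun w => _) = fun w => if \det (A w) == 0 then A w i j else
    (\det (A w))^-1 * cofactor (A w) j i); last first.
  apply/funext => w; rewrite /invmx unitmxE unitfE; case: eqP => //= _.
  by rewrite !mxE.
have mdet := measurable_det mA.
apply: measurable_fun_ifT; first by apply: measurable_fun_eqr.
  exact: mA.
apply: measurable_funM; first exact: (measurableT_comp measurable_inv).
apply: measurable_funM => //; apply: measurable_det => k l.
by under eq_fun do rewrite !mxE; exact: mA.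
Qed.

Definition poly_measurable (P : Omega -> {poly R}) :=
  forall k, measurable_fun setT (fun w => (P w)`_k).

Lemma poly_measurable_cst (P : {poly R}) : poly_measurable (fun=> P).
Proof. by move=> k; exact: measurable_cst. Qed.

Lemma poly_measurableM P Q : poly_measurable P -> poly_measurable Q ->
  poly_measurable (fun w => P w * Q w).
Proof.
move=> mP mQ k; under eq_fun do rewrite coefM.
by apply: measurable_sum => i; apply: measurable_funM.
Qed.

Lemma poly_measurable_char_poly n (A : Omega -> 'M[R]_n) :
  mx_measurable A -> poly_measurable (fun w => char_poly (A w)).
Proof.
move=> mA; have mE i j : poly_measurable (fun w => char_poly_mx (A w) i j).
  move=> k; under eq_fun do rewrite !mxE coefB coefC.
  apply: measurable_funB; first exact: measurable_cst.
  by case: (k == 0)%N; [exact: mA|exact: measurable_cst].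
move=> k; rewrite /char_poly /determinant; under eq_fun do rewrite coef_sum.
apply: measurable_sum => s; move: k.
apply: poly_measurableM; first exact: poly_measurable_cst.
elim: (index_enum _) => [|i js IH] k.
  by under eq_fun do rewrite big_nil; exact: measurable_cst.
under eq_fun do rewrite big_cons; move: k.
by apply: poly_measurableM.
Qed.

End measurable_matrices.

Lemma row_norm_le (R : realType) d (x : 'rV[R]_d) (h : R) :
  (`|x| <= h) = (0 <= h) && [forall j, `|x 0 j| <= h].
Proof.
rewrite /Num.Def.normr/= mx_normrE; apply/bigmax_leP/andP => /=.
  by move=> [h0 H]; split => //; apply/forallP => j; exact: (H (0, j)).
by move=> [h0 /forallP H]; split => // -[i j] _ /=; rewrite ord1; exact: H.
Qed.

Section good_cell_measurable.
Context (R : realType) (d q : nat) (psi : 'I_q -> mpoly d R).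
Context (s : 'I_d -> nat) (n : nat) (Q : cell s) (kappa v0 h : R).

Definition design_on (S : {set 'I_n}) (X : 'I_n -> 'rV[R]_d) : 'M[R]_(#|S|, q) :=
  \matrix_(r, k) meval (fun j => rescale Q (X (enum_val r)) 0 j) (psi k).

(** The matrices of a good cell have a dimension that depends on the random
    set of indices of its points.  Fixing this set [S] makes the dimension
    deterministic; for [S] the set of indices of the cell, [good_on S X]
    unfolds to [good_cell]. *)
Definition good_on (S : {set 'I_n}) (X : 'I_n -> 'rV[R]_d) : bool :=
  let D := design_on S X in
  let U r := rescale Q (X (enum_val r)) in
  [&& #|S| == q.+2, kappa <= lambda_min (#|S|%:R^-1 *: (D^T *m D)) &
    finset (fun e : 'I_#|S| * 'I_#|S| =>
      [&& (e.1 < e.2)%N, `|U e.1 - U e.2| <= h &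
        v0 <= ((delta_mx e.1 0 - delta_mx e.2 0 : 'cV[R]_#|S|)^T *m
          (1%:M - D *m invmx (D^T *m D) *m D^T) *m
          (delta_mx e.1 0 - delta_mx e.2 0 : 'cV[R]_#|S|)) 0 0])
      != finset.set0].

Hypothesis q_gt0 : (0 < q)%N.
Context (disp : measure_display) (Omega : measurableType disp).
Context (X : Omega -> 'I_n -> 'rV[R]_d).
Hypothesis mX : forall i j, measurable_fun setT (fun w => X w i 0 j).

Lemma in_cell_measurable i : fin_measurable (fun w => in_cell Q (X w i)).
Proof.
apply: fin_measurable_forall => j; apply: fin_measurable_fun_bool.
apply: measurable_or; apply: measurable_and; [| | |].
- by apply: measurable_fun_ler.
- by apply: measurable_fun_ltr.
- exact: measurable_cst.
- by apply: measurable_fun_eqr.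
Qed.

Lemma rescale_measurable i j :
  measurable_fun setT (fun w => rescale Q (X w i) 0 j).
Proof.
under eq_fun do rewrite mxE.
apply: measurable_funM; last exact: measurable_cst.
by apply: measurable_funB => //; exact: mX.
Qed.

Lemma meval_measurable (p : mpoly d R) (Y : Omega -> 'I_d -> R) :
  (forall j, measurable_fun setT (fun w => Y w j)) ->
  measurable_fun setT (fun w => meval (Y w) p).
Proof.
move=> mY; under eq_fun do rewrite mevalE.
apply: measurable_sum => m; apply: measurable_funM; first exact: measurable_cst.
by apply: measurable_prod => j _; exact: measurable_funX.
Qed.

(** The characterization by the coefficients of the characteristic polynomial
    replaces an infimum over uncountably many candidates by countably many
    measurable conditions. *)
Lemma lambda_min_measurable m (A : Omega -> 'M[R]_m) (k : R) : (0 < m)%N ->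
  (forall w, (A w)^T = A w) -> mx_measurable A ->
  fin_measurable (fun w => k <= lambda_min (A w)).
Proof.
move=> m0 Asym mA; apply: fin_measurable_bool.
rewrite (_ : [set w | _] = \bigcap_i [set w | 0 <= (char_poly (k%:M - A w))`_i]).
  apply: bigcap_measurable => [|i _]; first by exists 0%N.
  rewrite -[X in measurable X]setTI; apply: measurable_fun_le => //.
  apply: poly_measurable_char_poly; apply: mx_measurable_sub => //.
by apply/seteqP; split=> w /=; rewrite lambda_min_char_poly// => H i; [move=> _|]; apply: H.
Qed.

Lemma good_on_measurable (S : {set 'I_n}) : fin_measurable (fun w => good_on S (X w)).
Proof.
have mD : mx_measurable (fun w => design_on S (X w)).
  move=> r k; under eq_fun do rewrite mxE.
  by apply: meval_measurable => j; exact: rescale_measurable.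
have mDt := mx_measurable_tr mD.
have mG := mx_measurable_mul mDt mD.
apply: (fin_measurable_op2 andb); first exact: fin_measurable_cst.
apply: (fin_measurable_op2 andb).
  apply: lambda_min_measurable => //; first by move=> w; rewrite linearZ/= trmx_mul trmxK.
  exact: mx_measurable_scale.
apply: (fin_measurable_comp (fun E : {set 'I_#|S| * 'I_#|S|} => E != finset.set0)).
apply: fin_measurable_set => e.
apply: (fin_measurable_op2 andb); first exact: fin_measurable_cst.
apply: (fin_measurable_op2 andb).
  under eq_fun do rewrite row_norm_le.
  apply: (fin_measurable_op2 andb); first exact: fin_measurable_cst.
  apply: fin_measurable_forall => j; apply: fin_measurable_fun_bool.
  apply: measurable_fun_ler; last exact: measurable_cst.
  under eq_fun do rewrite [X in `|X|]mxE [X in `|_ + X|]mxE.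
  apply: measurableT_comp => //.
  by apply: measurable_funB; exact: rescale_measurable.
apply: fin_measurable_fun_bool; apply: measurable_fun_ler; first exact: measurable_cst.
apply: mx_measurable_mul; last exact: mx_measurable_cst.
apply: mx_measurable_mul; first exact: mx_measurable_cst.
apply: mx_measurable_sub; first exact: mx_measurable_cst.
apply: mx_measurable_mul => //; apply: mx_measurable_mul => //.
exact: mx_measurable_inv.
Qed.

Lemma good_cell_measurable :
  fin_measurable (fun w => good_cell psi (X w) Q kappa v0 h).
Proof.
have mI : fin_measurable (fun w => cell_indices (X w) Q).
  by apply: fin_measurable_set => i; exact: in_cell_measurable.
apply: fin_measurable_bool.
rewrite (_ : [set w | _] = \bigcup_(S in [set: {set 'I_n}])
   ([set w | cell_indices (X w) Q = S] `&` [set w | good_on S (X w)])).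
  apply: fin_bigcup_measurable => // S _; apply: measurableI; first exact: mI.
  exact: (fin_measurable_pred id (good_on_measurable S)).
apply/seteqP; split=> [w /= gw|w [S _ [/= <-]]]; last by [].
by exists (cell_indices (X w) Q).
Qed.

End good_cell_measurable.

(** * From the observation law to finite products *)

(** The integral of a nonnegative function is a supremum over the simple
    functions below it, so it is monotone without measurability. *)
Lemma ge0_le_integral_nonmeasurable d (T : measurableType d) (R : realType)
    (mu : {measure set T -> \bar R}) (D : set T) (f g : T -> \bar R) :
  (forall x, D x -> 0 <= f x)%E -> (forall x, D x -> f x <= g x)%E ->
  (\int[mu]_(x in D) f x <= \int[mu]_(x in D) g x)%E.
Proof.
move=> f0 fg; have g0 x : D x -> (0 <= g x)%E.
  by move=> Dx; apply: le_trans (f0 _ Dx) (fg _ Dx).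
rewrite !ge0_integralE//; apply: ereal_sup_le => _ [h /= hf <-]; exists h => // x.
apply: le_trans (hf x) _; rewrite /patch; case: ifPn => // /set_mem; exact: fg.
Qed.

Definition closed_box (R : realType) d (a b : 'rV[R]_d) : set 'rV[R]_d :=
  [set x | forall j, x 0 j \in `[a 0 j, b 0 j]].

Lemma measurable_closed_box (R : realType) d (a b : 'rV[R]_d) :
  measurable (closed_box a b).
Proof.
rewrite (_ : closed_box a b = \bigcap_(j in [set: 'I_d])
    (fun x : 'rV[R]_d => x 0 j) @^-1` `[a 0 j, b 0 j]%classic); last first.
  by apply/seteqP; split => x /= H j *; exact: H.
apply: fin_bigcap_measurable => // j _.
by rewrite -[X in measurable X]setTI; exact: measurable_row_coord.
Qed.

Lemma measurable_cube (R : realType) d : measurable (@cube R d).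
Proof.
rewrite (_ : @cube R d = closed_box 0 (const_mx 1)); first exact: measurable_closed_box.
by apply/seteqP; split => x H j; have := H j; rewrite !mxE.
Qed.

Section observation_law.
Context (R : realType) (d : nat) (theta : model_param R d) (pl pu : R).
Hypothesis pl_ge0 : 0 <= pl.
Hypothesis dens_bounds : forall x, cube x -> pl <= dens theta x <= pu.

(** The noise kernel is a probability, so events on the design have the mass
    of their density. *)
Lemma obs_law_ge (B : set 'rV[R]_d) (a b : 'rV[R]_d) :
  (forall j, a 0 j <= b 0 j) -> closed_box a b `<=` @cube R d `&` B ->
  ((pl * \prod_j (b 0 j - a 0 j))%:E <= obs_law theta [set z | B z.1])%E.
Proof.
move=> ab abB; rewrite EFinM -lebesgue_row_box//.
rewrite -/(closed_box a b) -[closed_box a b](setIidl (fun x h => (abB x h).1)).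
rewrite -integral_indic; [|exact: measurable_cube|exact: measurable_closed_box].
rewrite -ge0_integralZl_EFin//; last 2 first.
- exact: measurable_cube.
- by apply/measurable_EFinP; exact: measurable_indic (measurable_closed_box _ _).
apply: ge0_le_integral_nonmeasurable => x cx /=.
  by rewrite mule_ge0// lee_fin.
have /andP[px _] := dens_bounds cx.
rewrite indicE; have [xab|xab] := boolP (x \in closed_box a b); last first.
  by rewrite mule0 mule_ge0// lee_fin (le_trans pl_ge0).
have /abB[_ Bx] := set_mem xab.
rewrite (_ : [set u | B x] = setT) ?prob_kernel ?mule1 ?lee_fin//.
by apply/seteqP; split.
Qed.

Lemma obs_law_le (B : set 'rV[R]_d) (a b : 'rV[R]_d) :
  (forall j, a 0 j <= b 0 j) -> @cube R d `&` B `<=` closed_box a b ->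
  0 <= pu ->
  (obs_law theta [set z | B z.1] <= (pu * \prod_j (b 0 j - a 0 j))%:E)%E.
Proof.
move=> ab abB pu0; rewrite EFinM -lebesgue_row_box//.
apply: (@le_trans _ _ (pu%:E * lebesgue_row R d (closed_box a b `&` @cube R d))%E); last first.
  rewrite lee_wpmul2l ?lee_fin// le_measure ?inE//.
  - by apply: measurableI; [exact: measurable_closed_box|exact: measurable_cube].
  - exact: measurable_closed_box.
rewrite -integral_indic; [|exact: measurable_cube|exact: measurable_closed_box].
rewrite -ge0_integralZl_EFin//; last 2 first.
- exact: measurable_cube.
- by apply/measurable_EFinP; exact: measurable_indic (measurable_closed_box _ _).
apply: ge0_le_integral_nonmeasurable => x cx /=; have /andP[p1 p2] := dens_bounds cx.
  by rewrite mule_ge0// lee_fin (le_trans pl_ge0).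
have [Bx|Bx] := pselect (B x); last first.
  rewrite (_ : [set u | B x] = set0) ?measure0 ?mule0 ?mule_ge0 ?lee_fin//.
  by apply/seteqP; split.
rewrite (_ : [set u | B x] = setT) ?prob_kernel ?mule1; last by apply/seteqP; split.
by rewrite indicE mem_set ?mule1 ?lee_fin//; exact: abB.
Qed.

End observation_law.

Lemma sum_fin_prob d (Omega : measurableType d) (R : realType)
    (P : probability Omega R) (T : finType) (f : Omega -> T) (A : pred T) :
  fin_measurable f ->
  P [set w | A (f w)] = (\sum_(v | A v) fine (P [set w | f w = v]))%:E.
Proof.
move=> mf; rewrite -big_filter; set s := [seq v <- _ | A v].
have -> : [set w | A (f w)] = [set w | f w \in s].
  by apply/seteqP; split=> w /=; rewrite mem_filter mem_index_enum andbT.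
have : uniq s by rewrite filter_uniq// index_enum_uniq.
elim: s => [_|v s IH /= /andP[vs us]].
  by rewrite big_nil (_ : [set w | _] = set0) ?measure0//; apply/seteqP; split.
rewrite big_cons EFinD fineK; last by apply: fin_num_measure; exact: mf.
rewrite -IH// -measureU.
- congr (P _); apply/seteqP; split=> w /=.
    by rewrite inE => /orP[/eqP|]; [left|right].
  by rewrite inE => -[->|->]; rewrite ?eqxx ?orbT.
- exact: mf.
- exact: (fin_measurable_pred (fun x => x \in s)).
- by apply/seteqP; split=> // w /= [-> vs']; rewrite vs' in vs.
Qed.

Section labels.
Context (R : realType) (d : nat) (theta : model_param R d).
Context (T : finType) (lab : 'rV[R]_d -> T).
Hypothesis mlab : fin_measurable lab.

Definition label_pmf (v : T) : R := fine (obs_law theta [set z | lab z.1 = v]).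

Context (disp : measure_display) (Omega : measurableType disp).
Context (P : probability Omega R) (n : nat).
Context (Z : 'I_n -> {RV P >-> ('rV[R]_d * R)%type}).
Hypothesis iid : iid_sample theta Z.

Lemma fst_fin_measurable : fin_measurable (fun z : 'rV[R]_d * R => lab z.1).
Proof.
move=> v; rewrite (_ : [set z | _] = fst @^-1` [set x | lab x = v])//.
rewrite -[X in measurable X]setTI; apply: measurable_fst => //; exact: mlab.
Qed.

Lemma label_pmf_ge0 v : (0 < n)%N -> 0 <= label_pmf v.
Proof.
case: n Z iid => // n' Z' [dist _] _; rewrite /label_pmf fine_ge0//.
by rewrite -(dist ord0)//; exact: fst_fin_measurable.
Qed.

Lemma sum_label_pmf (A : pred T) : (0 < n)%N ->
  obs_law theta [set z | A (lab z.1)] = (\sum_(v | A v) label_pmf v)%:E.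
Proof.
case: n Z iid => // n' Z' [dist _] _.
rewrite -(dist ord0); last exact: (fin_measurable_pred A fst_fin_measurable).
rewrite (sum_fin_prob _ A fst_fin_measurable); congr EFin.
by apply: eq_bigr => v _; rewrite /label_pmf -(dist ord0)//; exact: fst_fin_measurable.
Qed.

Lemma sum_label_pmfT : (0 < n)%N -> \sum_v label_pmf v = 1.
Proof.
move=> n0; apply: EFin_inj; rewrite -(sum_label_pmf xpredT n0).
case: n Z iid n0 => // n' Z' [dist _] _.
rewrite (_ : [set z | _] = setT); last by apply/seteqP; split.
by rewrite -(dist ord0)// probability_setT.
Qed.

(** Mutual independence of the observations makes the labels independent. *)
Lemma sample_label_prob (v : {ffun 'I_n -> T}) :
  P [set w | [ffun i => lab (Z i w).1] = v] = (\prod_i label_pmf (v i))%:E.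
Proof.
have [dist ind] := iid.
rewrite (_ : [set w | _] = \bigcap_(i in [set: 'I_n]) Z i @^-1` [set z | lab z.1 = v i]).
  rewrite ind; last by move=> i; exact: fst_fin_measurable.
  rewrite -prodEFin; apply: eq_bigr => i _.
  have E : P (Z i @^-1` [set z | lab z.1 = v i]) = obs_law theta [set z | lab z.1 = v i].
    by rewrite -(dist i)//; exact: fst_fin_measurable.
  by rewrite /label_pmf fineK// -E fin_num_measure// -[X in measurable X]setTI;
    apply: measurable_funPT => //; exact: fst_fin_measurable.
apply/seteqP; split=> w /=; first by move=> <- i _ /=; rewrite ffunE.
by move=> h; apply/ffunP => i; rewrite ffunE; exact: h.
Qed.

Lemma sample_prob_le (A : set Omega) (E : pred {ffun 'I_n -> T}) :
  measurable A -> (forall w, A w -> E [ffun i => lab (Z i w).1]) ->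
  (P A <= (\sum_(v : {ffun 'I_n -> T}) (\prod_i label_pmf (v i)) * (E v)%:R)%:E)%E.
Proof.
move=> mA AE.
have mV : fin_measurable (fun w => [ffun i => lab (Z i w).1]).
  apply: fin_measurable_ffun => i v.
  rewrite (_ : [set w | _] = Z i @^-1` [set z | lab z.1 = v])//.
  rewrite -[X in measurable X]setTI; apply: measurable_funPT => //.
  exact: fst_fin_measurable.
apply: (@le_trans _ _ (P [set w | E [ffun i => lab (Z i w).1]])).
  by rewrite le_measure// inE//; exact: (fin_measurable_pred E mV).
rewrite (sum_fin_prob _ E mV) lee_fin big_mkcond/=; apply: ler_sum => v _.
rewrite sample_label_prob; case: (E v); first by rewrite mulr1.
by rewrite mulr0.
Qed.

End labels.

(** * Cells and labels *)

Section cell_geometry.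
Context (R : realType) (d : nat) (s : 'I_d -> nat).
Implicit Types (Q : cell s) (x a b : 'rV[R]_d).

Definition in_box a b x : bool := [forall j, a 0 j <= x 0 j <= b 0 j].

(** Inverse of the rescaling map of the cell [Q]. *)
Definition cell_map Q (a : 'rV[R]_d) : 'rV[R]_d :=
  \row_j (cell_corner R Q 0 j + cell_side R s 0 j * a 0 j).

Lemma cell_side_gt0 j : 0 < cell_side R s 0 j.
Proof. by rewrite mxE invr_gt0 exprn_gt0. Qed.

Lemma cell_corner_ge0 Q j : 0 <= cell_corner R Q 0 j.
Proof. by rewrite mxE divr_ge0// exprn_ge0. Qed.

Lemma cell_corner_side Q j : cell_corner R Q 0 j + cell_side R s 0 j <= 1.
Proof.
rewrite !mxE -[X in _ + X]mul1r -mulrDl ler_pdivrMr ?exprn_gt0// mul1r.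
by rewrite -natrX natr1 ler_nat ltn_ord.
Qed.

Lemma box_in_cell Q a b x : (forall j, 0 <= a 0 j) -> (forall j, b 0 j < 1) ->
  closed_box (cell_map Q a) (cell_map Q b) x ->
  [/\ cube x, in_cell Q x & in_box a b (rescale Q x)].
Proof.
move=> a0 b1 xab.
have H j : [/\ 0 <= x 0 j <= 1,
    cell_corner R Q 0 j <= x 0 j < cell_corner R Q 0 j + cell_side R s 0 j &
    a 0 j <= (x 0 j - cell_corner R Q 0 j) / cell_side R s 0 j <= b 0 j].
  have := xab j; rewrite in_itv/= [cell_map Q a 0 j]mxE [cell_map Q b 0 j]mxE.
  move: (cell_side_gt0 j) (cell_corner_ge0 Q j) (cell_corner_side Q j) (a0 j) (b1 j).
  move: (cell_corner R Q 0 j) (cell_side R s 0 j) (x 0 j) (a 0 j) (b 0 j).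
  move=> c w y u v w0 c0 cw1 u0 v1 /andP[yl yu].
  rewrite ler_pdivlMr// ler_pdivrMr//.
  have h1 : 0 <= w * u by rewrite mulr_ge0// ltW.
  have h2 : w * v < w by rewrite gtr_pMr.
  by split; apply/andP; split; lra.
split; first by move=> j; rewrite in_itv/=; case: (H j).
  by apply/forallP => j; case: (H j) => _ -> _.
by apply/forallP => j; rewrite [rescale _ _ _ _]mxE; case: (H j).
Qed.

Lemma in_cell_box Q x : cube x -> in_cell Q x ->
  closed_box (cell_map Q 0) (cell_map Q (const_mx 1)) x.
Proof.
move=> cx /forallP xQ j.
have E0 : cell_map Q 0 0 j = cell_corner R Q 0 j.
  by rewrite mxE [(0 : 'rV[R]_d) 0 j]mxE mulr0 addr0.
have E1 : cell_map Q (const_mx 1) 0 j = cell_corner R Q 0 j + cell_side R s 0 j.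
  by rewrite mxE [const_mx _ 0 j]mxE mulr1.
rewrite in_itv/= E0 E1.
have /orP[/andP[-> /ltW->]//|/andP[/eqP Qj /eqP ->]] := xQ j.
have E : cell_corner R Q 0 j + cell_side R s 0 j = 1.
  by rewrite !mxE -[X in _ + X]mul1r -mulrDl natr1 Qj natrX divff// expf_neq0.
by rewrite E lexx andbT -E lerDl ltW// cell_side_gt0.
Qed.

Lemma in_cell_inj Q Q' x : in_cell Q x -> in_cell Q' x -> Q = Q'.
Proof.
move=> /forallP xQ /forallP xQ'; apply/ffunP => j; apply/val_inj/eqP => /=.
have w0 : (0 : R) < 2 ^+ s j by rewrite exprn_gt0.
have bnd (k : 'I_(2 ^ s j)) : (k%:R / 2 ^+ s j <= x 0 j < k%:R / 2 ^+ s j + (2 ^+ s j)^-1) ->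
   k%:R <= x 0 j * 2 ^+ s j < k.+1%:R.
  rewrite -[X in _ + X]mul1r -mulrDl natr1 => /andP[h1 h2]; apply/andP; split.
    by rewrite -ler_pdivrMr.
  by rewrite -ltr_pdivlMr.
have one (k k' : 'I_(2 ^ s j)) : (k.+1 == 2 ^ s j)%N && (x 0 j == 1) ->
    k'%:R <= x 0 j * 2 ^+ s j < k'.+1%:R -> False.
  move=> /andP[_ /eqP ->]; rewrite mul1r -natrX => /andP[_].
  by rewrite ltr_nat ltnS leqNgt ltn_ord.
move: (xQ j) (xQ' j); rewrite !mxE => /orP[/bnd/andP[h1 h2]|e1] /orP[/bnd/andP[h3 h4]|e2].
- rewrite eqn_leq; apply/andP; split; rewrite -ltnS -(ltr_nat R).
    exact: le_lt_trans h1 h4.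
  exact: le_lt_trans h3 h2.
- by exfalso; apply: (one _ (Q j) e2); rewrite h1.
- by exfalso; apply: (one _ (Q' j) e1); rewrite h3.
- by move: e1 e2 => /andP[/eqP e1 _] /andP[/eqP e2 _]; rewrite -eqSS e1 e2.
Qed.

Lemma card_cell : #|{: cell s}| = (2 ^ \sum_j s j)%N.
Proof.
rewrite card_dep_ffun foldrE big_map big_enum/= expn_sum.
by apply: eq_bigr => j _; rewrite card_ord.
Qed.

Lemma cell_map_volume Q a b :
  \prod_j (cell_map Q b 0 j - cell_map Q a 0 j) =
  \prod_j (b 0 j - a 0 j) / (2 ^ \sum_j s j)%N%:R.
Proof.
under eq_bigr => j _.
  rewrite (_ : _ - _ = (b 0 j - a 0 j) * cell_side R s 0 j); last by rewrite !mxE; ring.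
  over.
rewrite big_split/=; congr (_ * _).
rewrite expn_sum natr_prod -prodfV; apply: eq_bigr => j _.
by rewrite mxE natrX.
Qed.

End cell_geometry.

Section good_design.
Context (R : realType) (d q : nat) (psi : 'I_q -> mpoly d R).
Context (u : 'I_q -> 'rV[R]_d) (rho lam B : R).
Hypotheses (q_gt0 : (0 < q)%N) (lam_gt0 : 0 < lam) (B_gt0 : 0 < B).
Hypothesis lam_le : forall x : 'I_q -> 'rV[R]_d,
  (forall r j, `|x r 0 j - u r 0 j| <= rho) ->
  forall c : 'cV[R]_q, lam * (\sum_k c k 0 ^+ 2) <= \sum_r poly_vec psi c (x r) ^+ 2.
Hypothesis B_ge : forall x, cube x -> forall c : 'cV[R]_q,
  poly_vec psi c x ^+ 2 <= B * (\sum_k c k 0 ^+ 2).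

(** The rows 0 and 1 are the pair and the row [k + 2] is close to the node
    [k]; the node rows alone bound the Gram matrix below. *)
Lemma good_design N (y : 'I_N -> 'rV[R]_d)
    (Phi := \matrix_(r, k) meval (fun j => y r 0 j) (psi k)) :
  N = q.+2 -> (forall r : 'I_N, (r < 2)%N -> cube (y r)) ->
  (forall (r : 'I_N) (k : 'I_q), r = k.+2 :> nat -> forall j, `|y r 0 j - u k 0 j| <= rho) ->
  lam / q.+2%:R <= lambda_min (N%:R^-1 *: (Phi^T *m Phi)) /\
  forall e0 e1 : 'I_N, e0 = 0%N :> nat -> e1 = 1%N :> nat ->
  Num.min 4^-1 (lam / (4 * B)) <=
  (((delta_mx e0 0 - delta_mx e1 0 : 'cV[R]_N)^T *m
   (1%:M - Phi *m invmx (Phi^T *m Phi) *m Phi^T) *m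
   (delta_mx e0 0 - delta_mx e1 0 : 'cV[R]_N)) 0 0).
Proof.
move=> Nq; subst N => ycube yu.
have PhiE (c : 'cV[R]_q) r : (Phi *m c) r 0 = poly_vec psi c (y r).
  by rewrite mxE; apply: eq_bigr => k _; rewrite mxE.
pose x (k : 'I_q) := y (lift ord0 (lift ord0 k)).
have lamx (c : 'cV[R]_q) : lam * (c^T *m c) 0 0 <= \sum_k poly_vec psi c (x k) ^+ 2.
  rewrite sqnormE; apply: lam_le => k j; exact: yu.
have split2 (c : 'cV[R]_q) : ((Phi *m c)^T *m (Phi *m c)) 0 0 =
    (Phi *m c) ord0 0 ^+ 2 + ((Phi *m c) (lift ord0 ord0) 0 ^+ 2 +
    \sum_k poly_vec psi c (x k) ^+ 2).
  rewrite sqnormE !big_ord_recl; congr (_ + (_ + _)).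
  by apply: eq_bigr => k _; rewrite PhiE.
have Phi_ge (c : 'cV[R]_q) : lam * (c^T *m c) 0 0 <= ((Phi *m c)^T *m (Phi *m c)) 0 0.
  by rewrite split2; apply: le_trans (lamx c) _; rewrite !ler_wpDl ?sqr_ge0.
split; first by apply: lambda_min_gram.
move=> e0 e1 e00 e11; apply: (residual_pair_ge lam_gt0 Phi_ge) => //.
- by rewrite -val_eqE /= e00 e11.
- move=> c; rewrite PhiE sqnormE; apply: B_ge; apply: ycube; rewrite e00//.
move=> c; apply: le_trans (lamx c) _.
rewrite [leRHS]big_mkcond !big_ord_recl/= (_ : e0 = ord0); last exact: val_inj.
rewrite (_ : e1 = lift ord0 ord0); last exact: val_inj.
rewrite eqxx andbF !add0r; apply: ler_sum => k _.
by rewrite PhiE.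
Qed.

End good_design.

Section cell_labels.
Context (R : realType) (d q : nat) (s : 'I_d -> nat) (M : nat).
Context (lo hi : 'I_q -> 'rV[R]_d).
Hypothesis M_gt0 : (0 < M)%N.

Local Notation grid := {ffun 'I_d -> 'I_M}.
Local Notation L := (option grid * {ffun 'I_q -> bool})%type.

(** The grid boxes fill only half of the mesh in each direction, so that these
    closed boxes are pairwise disjoint. *)
Definition grid_lo (k : grid) : 'rV[R]_d := \row_j ((k j)%:R / M%:R).
Definition grid_hi (k : grid) : 'rV[R]_d := \row_j (((k j)%:R + 2^-1) / M%:R).

(** What is remembered of the rescaled position of a point: the grid box that
    contains it, if any, and the node boxes that contain it. *)
Definition box_label (x : 'rV[R]_d) : L :=
  ([pick k | in_box (grid_lo k) (grid_hi k) x], [ffun r => in_box (lo r) (hi r) x]).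

Definition cell_label (x : 'rV[R]_d) : option (cell s) * L :=
  if [pick Q : cell s | in_cell Q x] is Some Q
  then (Some Q, box_label (rescale (s := s) Q x)) else (None, (None, [ffun=> false])).

Lemma grid_disjoint k k' x :
  in_box (grid_lo k) (grid_hi k) x -> in_box (grid_lo k') (grid_hi k') x -> k = k'.
Proof.
move=> /forallP xk /forallP xk'; apply/ffunP => j; apply/val_inj/eqP => /=.
have M0 : (0 : R) < M%:R by rewrite ltr0n.
have := xk j; have := xk' j; rewrite !mxE => /andP[h1 h2] /andP[h3 h4].
have lt2 (a b : nat) : (a%:R / M%:R : R) <= (b%:R + 2^-1) / M%:R -> (a <= b)%N.
  by rewrite ler_pM2r ?invr_gt0// => h; rewrite -ltnS -(ltr_nat R) -natr1; lra.
by rewrite eqn_leq (lt2 _ _ (le_trans h1 h4)) (lt2 _ _ (le_trans h3 h2)).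
Qed.

Lemma box_label_grid k x : (box_label x).1 == Some k = in_box (grid_lo k) (grid_hi k) x.
Proof.
rewrite /box_label /=; case: pickP => [k' xk'|no]; last by rewrite no.
apply/eqP/idP => [[<-]//|xk]; congr Some; exact: grid_disjoint xk' xk.
Qed.

Lemma cell_label1 (Q : cell s) x : (cell_label x).1 == Some Q = in_cell Q x.
Proof.
rewrite /cell_label; case: pickP => [Q' xQ'|no]; last by rewrite no.
by apply/eqP/idP => [[<-]//|xQ]; congr Some; exact: in_cell_inj xQ' xQ.
Qed.

Lemma cell_label2 (Q : cell s) x : in_cell Q x -> (cell_label x).2 = box_label (rescale Q x).
Proof.
rewrite /cell_label; case: pickP => [Q' xQ' xQ|->//].
by rewrite (in_cell_inj xQ' xQ).
Qed.

Lemma cell_label_measurable : fin_measurable cell_label.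
Proof.
have mcoord (j : 'I_d) : measurable_fun setT (fun x : 'rV[R]_d => x 0 j).
  exact: measurable_row_coord.
have mX (i : 'I_1) j : measurable_fun setT (fun w : 'rV[R]_d => (fun i : 'I_1 => w) i 0 j).
  exact: mcoord.
have mbox (a b : 'rV[R]_d) (Q : cell s) : fin_measurable (fun x => in_box a b (rescale Q x)).
  apply: fin_measurable_forall => j; apply: fin_measurable_fun_bool.
  have mr := rescale_measurable Q mX ord0 j.
  by apply: measurable_and; apply: measurable_fun_ler => //; exact: measurable_cst.
have mpick (I : finType) (b : I -> 'rV[R]_d -> bool) :
    (forall i, fin_measurable (b i)) -> fin_measurable (fun x => [pick i | b i x]).
  move=> mb; rewrite (_ : (fun x => _) = fun x => [pick i | [ffun i => b i x] i]); last first.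
    by apply/funext => x; apply: eq_pick => i; rewrite ffunE.
  apply: (fin_measurable_comp (fun v : {ffun I -> bool} => [pick i | v i])).
  exact: fin_measurable_ffun.
pose attach (c : option (cell s)) (F : {ffun cell s -> L}) : option (cell s) * L :=
  if c is Some Q then (Some Q, F Q) else (None, (None, [ffun=> false])).
rewrite (_ : cell_label = fun x => attach [pick Q : cell s | in_cell Q x]
    [ffun Q : cell s => box_label (rescale Q x)]); last first.
  apply/funext => x; rewrite /cell_label; case: pickP => // Q _.
  by rewrite /attach ffunE.
apply: (fin_measurable_op2 attach).
  by apply: mpick => Q; exact: (in_cell_measurable Q mX ord0).
apply: fin_measurable_ffun => Q; apply: fin_measurable_pair.
  by apply: mpick => k; exact: mbox.
by apply: fin_measurable_ffun => r; exact: mbox.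
Qed.

(** The pattern [k] asks that the first two points of a cell lie in the grid
    box [k] and that the point of index [j + 2] lie in the node box [j]. *)
Definition role_labels (k : grid) (r : nat) : {set L} :=
  finset (fun l : L => if (r < 2)%N then l.1 == Some k
    else if insub (r - 2)%N is Some j then l.2 j else true).

Lemma role_disjoint (k k' : grid) (l : L) : l \in role_labels k 0 -> l \in role_labels k' 0 -> k = k'.
Proof. by rewrite !inE /= => /eqP -> /eqP[]. Qed.

End cell_labels.

Section hits_are_good.
Context (R : realType) (d q : nat) (psi : 'I_q -> mpoly d R).
Context (u : 'I_q -> 'rV[R]_d) (rho lam B : R).
Hypotheses (q_gt0 : (0 < q)%N) (lam_gt0 : 0 < lam) (B_gt0 : 0 < B).
Hypotheses (rho_gt0 : 0 < rho) (rho_le1 : rho <= 1) (cube_u : forall r, cube (u r)).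
Hypothesis lam_le : forall x : 'I_q -> 'rV[R]_d,
  (forall r j, `|x r 0 j - u r 0 j| <= rho) ->
  forall c : 'cV[R]_q, lam * (\sum_k c k 0 ^+ 2) <= \sum_r poly_vec psi c (x r) ^+ 2.
Hypothesis B_ge : forall x, cube x -> forall c : 'cV[R]_q,
  poly_vec psi c x ^+ 2 <= B * (\sum_k c k 0 ^+ 2).

(** The box [node_lo, node_hi] has side [rho / 2] and lies within [rho] of the
    node.  It starts from a contraction of the node towards the origin so as to
    stay in the half-open cube, away from the faces shared by the cells. *)
Definition node_lo (r : 'I_q) : 'rV[R]_d := \row_j ((1 - rho) * u r 0 j).
Definition node_hi (r : 'I_q) : 'rV[R]_d := \row_j ((1 - rho) * u r 0 j + rho / 2).

Lemma node_box_bounds r j :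
  [/\ 0 <= node_lo r 0 j, node_hi r 0 j < 1 & node_hi r 0 j - node_lo r 0 j = rho / 2].
Proof.
rewrite !mxE; have := cube_u r j; rewrite in_itv/= => /andP[u0 u1].
split; [by rewrite mulr_ge0// subr_ge0| |by rewrite addrAC subrr add0r].
have : (1 - rho) * u r 0 j <= (1 - rho) * 1 by rewrite ler_wpM2l// subr_ge0.
by rewrite mulr1 => h; move: rho_gt0; lra.
Qed.

Lemma node_box_near r x : in_box (node_lo r) (node_hi r) x ->
  forall j, `|x 0 j - u r 0 j| <= rho.
Proof.
move=> /forallP h j; have := h j; rewrite !mxE => /andP[h1 h2].
have := cube_u r j; rewrite in_itv/= => /andP[u0 u1].
have a1 : rho * u r 0 j <= rho * 1 by rewrite ler_wpM2l// ltW.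
have a2 : 0 <= rho * u r 0 j by rewrite mulr_ge0// ltW.
by rewrite ler_norml; apply/andP; split; move: rho_gt0; lra.
Qed.

Context (s : 'I_d -> nat) (M n : nat).
Hypothesis M_gt0 : (0 < M)%N.

Lemma grid_box_cube (k : {ffun 'I_d -> 'I_M}) x :
  in_box (grid_lo R k) (grid_hi R k) x -> cube x.
Proof.
move=> /forallP h j; have := h j; rewrite !mxE in_itv/= => /andP[h1 h2].
have M0 : (0 : R) < M%:R by rewrite ltr0n.
apply/andP; split; first by apply: le_trans h1; rewrite divr_ge0.
apply: le_trans h2 _; rewrite ler_pdivrMr// mul1r.
have : (k j).+1%:R <= M%:R :> R by rewrite ler_nat.
by rewrite -natr1; lra.
Qed.

Lemma grid_box_diam (k : {ffun 'I_d -> 'I_M}) x y (h : R) : M%:R^-1 <= h ->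
  in_box (grid_lo R k) (grid_hi R k) x -> in_box (grid_lo R k) (grid_hi R k) y ->
  `|x - y| <= h.
Proof.
move=> Mh /forallP hx /forallP hy; rewrite row_norm_le.
have M0 : (0 : R) < M%:R by rewrite ltr0n.
have Mi : (0 : R) < M%:R^-1 by rewrite invr_gt0.
apply/andP; split; first by apply: le_trans Mh; exact: ltW.
apply/forallP => j; have := hx j; have := hy j; rewrite !mxE mulrDl.
move=> /andP[h1 h2] /andP[h3 h4]; apply: le_trans Mh.
by rewrite ler_norml; apply/andP; split; lra.
Qed.

(** A hit cell has its first two points in a common grid box, hence at distance
    at most [1 / M], and one point near each node. *)
Lemma hit_cells_good (X : 'I_n -> 'rV[R]_d) (h : R) : M%:R^-1 <= h ->
  (hit_cells q.+2 (@role_labels d q M)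
     [ffun i => (cell_label s M node_lo node_hi (X i)).1]
     [ffun i => (cell_label s M node_lo node_hi (X i)).2]
   \subset good_cells psi s X (lam / q.+2%:R) (Num.min 4^-1 (lam / (4 * B))) h)%SET.
Proof.
move=> Mh; apply/fintype.subsetP => Q; rewrite !inE => /andP[/eqP Nq].
have EI : cell_of [ffun i => (cell_label s M node_lo node_hi (X i)).1] Q = cell_indices X Q.
  by apply/setP => i; rewrite !inE ffunE cell_label1.
rewrite {}EI in Nq *; move=> /existsP[k /forallP kP].
have lab (r : 'I_#|cell_indices X Q|) :
    box_label M node_lo node_hi (cell_point r) \in role_labels q k r.
  have inQ : in_cell Q (X (enum_val r)) by have := enum_valP r; rewrite inE.
  have := kP (enum_val r); rewrite enum_valP /= ffunE (cell_label2 _ _ _ inQ).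
  rewrite [X in role_labels q k X](_ : _ = val r)//.
  by rewrite (enum_val_nth (enum_default r)) index_uniq ?enum_uniq// -cardE.
have labg (r : 'I_#|cell_indices X Q|) : (r < 2)%N ->
    in_box (grid_lo R k) (grid_hi R k) (cell_point r).
  by move=> r2; have := lab r; rewrite inE r2 box_label_grid.
have labn (r : 'I_#|cell_indices X Q|) (j : 'I_q) : r = j.+2 :> nat ->
    in_box (node_lo j) (node_hi j) (cell_point r).
  move=> rj; have := lab r; rewrite inE rj /= subn2/=; case: insubP => [j' _ jj'|]; last first.
    by rewrite ltn_ord.
  by rewrite (_ : j' = j) ?ffunE//; apply: val_inj.
have [Hk Hv] := @good_design R d q psi u rho lam B q_gt0 lam_gt0 B_gt0 lam_le B_ge
  _ (@cell_point R d s n X Q) Nq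
  (fun r r2 => grid_box_cube (labg r r2))
  (fun r j rj => node_box_near (labn r j rj)).
have N0 : (0 < #|cell_indices X Q|)%N by rewrite Nq.
have N1 : (1 < #|cell_indices X Q|)%N by rewrite Nq.
apply/and3P; split; [by rewrite Nq|exact: Hk|].
apply/set0Pn; exists (Ordinal N0, Ordinal N1); rewrite inE /=.
apply/andP; split; last by apply: Hv.
by apply: (grid_box_diam Mh); apply: labg.
Qed.

End hits_are_good.

Lemma sum_pair_fst (R : realType) (T L : finType) (F : T * L -> R) (c : T) (A : pred L) :
  \sum_(v | (v.1 == c) && A v.2) F v = \sum_(l | A l) F (c, l).
Proof.
transitivity (\sum_(c' | c' == c) \sum_(l | A l) F (c', l)).
  by rewrite pair_big/=; apply: eq_bigr => -[].
by rewrite big_pred1_eq.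
Qed.

(** * Label probabilities *)

Section cell_label_law.
Context (R : realType) (d q : nat) (theta : model_param R d) (pl pu : R).
Hypotheses (pl_gt0 : 0 < pl) (pu_gt0 : 0 < pu).
Hypothesis dens_bounds : forall x, cube x -> pl <= dens theta x <= pu.
Context (s : 'I_d -> nat) (M : nat) (lo hi : 'I_q -> 'rV[R]_d) (rho : R).
Hypotheses (M_gt0 : (0 < M)%N) (rho_ge0 : 0 <= rho).
Hypothesis lohi : forall r j,
  [/\ 0 <= lo r 0 j, hi r 0 j < 1 & hi r 0 j - lo r 0 j = rho / 2].
Context (disp : measure_display) (Omega : measurableType disp).
Context (P : probability Omega R) (n : nat).
Context (Z : 'I_n -> {RV P >-> ('rV[R]_d * R)%type}).
Hypotheses (iid : iid_sample theta Z) (n_gt0 : (0 < n)%N).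

Local Notation J := (2 ^ \sum_j s j)%N.
Local Notation lab := (cell_label s M lo hi).
Local Notation pmf := (label_pmf theta lab).

Let J_gt0 : (0 : R) < J%:R.
Proof. by rewrite ltr0n expn_gt0. Qed.

(** The preimage of a box of the half-open unit cube under the rescaling of a
    cell is a box of volume reduced by the number of cells. *)
Lemma cell_pmf_box_ge (Q : cell s)
    (A : pred (option {ffun 'I_d -> 'I_M} * {ffun 'I_q -> bool}))
    (a b : 'rV[R]_d) : (forall j, 0 <= a 0 j) -> (forall j, a 0 j <= b 0 j) ->
  (forall j, b 0 j < 1) ->
  (forall x, in_box a b x -> A (box_label M lo hi x)) ->
  pl * \prod_j (b 0 j - a 0 j) / J%:R <= \sum_(l | A l) pmf (Some Q, l).
Proof.
move=> a0 ab b1 abA; rewrite -sum_pair_fst -lee_fin.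
rewrite -(sum_label_pmf (@cell_label_measurable R d q s M lo hi) iid
  (fun v => (v.1 == Some Q) && A v.2))//.
have h := @obs_law_ge R d theta pl pu (ltW pl_gt0) dens_bounds
  (fun x => ((lab x).1 == Some Q) && A (lab x).2) (cell_map Q a) (cell_map Q b).
rewrite cell_map_volume mulrA in h; apply: h.
  move=> j; rewrite !mxE lerD2l ler_wpM2l// ?invr_ge0 ?exprn_ge0//.
move=> x /(box_in_cell a0 b1)[cx xQ xab]; split => //=.
by rewrite cell_label1 xQ (cell_label2 _ _ _ xQ) abA.
Qed.

Lemma cell_pmf_le (Q : cell s) : \sum_l pmf (Some Q, l) <= pu / J%:R.
Proof.
rewrite -sum_pair_fst -lee_fin.
rewrite -(sum_label_pmf (@cell_label_measurable R d q s M lo hi) iid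
  (fun v => (v.1 == Some Q) && true))//.
have h := @obs_law_le R d theta pl pu (ltW pl_gt0) dens_bounds
  (fun x => ((lab x).1 == Some Q) && true) (cell_map Q 0) (cell_map Q (const_mx 1)).
rewrite cell_map_volume big1 ?mul1r in h; last first.
  by move=> j _; rewrite !mxE subr0.
apply: h; last exact: ltW.
  by move=> j; rewrite !mxE mulr0 mulr1 lerD2l invr_ge0 exprn_ge0.
by move=> x [cx]; rewrite andbT cell_label1; exact: in_cell_box.
Qed.

Lemma cell_pmf_ge (Q : cell s) : pl * 2^-1 ^+ d / J%:R <= \sum_l pmf (Some Q, l).
Proof.
have := @cell_pmf_box_ge Q xpredT 0 (const_mx 2^-1).
rewrite (eq_bigr (fun=> 2^-1)); last by move=> j _; rewrite !mxE subr0.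
rewrite prodr_const card_ord; by apply => //= j; rewrite !mxE; lra.
Qed.

(** The upper bound on the density enters through the mass of the whole cell,
    so these are bounds on conditional probabilities given the cell. *)
Lemma role_pmf_ge (Q : cell s) (k : {ffun 'I_d -> 'I_M}) (r : nat) : (r < q.+2)%N ->
  (if (r < 2)%N then pl / pu * (2 * M%:R)^-1 ^+ d else pl / pu * (rho / 2) ^+ d) *
    \sum_l pmf (Some Q, l) <= \sum_(l in role_labels q k r) pmf (Some Q, l).
Proof.
move=> rq.
have key (v : R) : 0 <= v -> pl * v / J%:R <= \sum_(l in role_labels q k r) pmf (Some Q, l) ->
   pl / pu * v * \sum_l pmf (Some Q, l) <= \sum_(l in role_labels q k r) pmf (Some Q, l).
  move=> v0; apply: le_trans.
  apply: (@le_trans _ _ (pl / pu * v * (pu / J%:R))).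
    by rewrite ler_wpM2l ?cell_pmf_le// mulr_ge0// divr_ge0// ltW.
  rewrite le_eqVlt; apply/orP; left; apply/eqP; field.
  by rewrite !gt_eqF.
have M0 : (0 : R) < M%:R by rewrite ltr0n.
case: ifPn => r2; apply: key.
- by rewrite exprn_ge0// invr_ge0 mulr_ge0.
- have := @cell_pmf_box_ge Q (fun l => l \in role_labels q k r) (grid_lo R k) (grid_hi R k).
  rewrite (eq_bigr (fun=> (2 * M%:R)^-1)); last first.
    by move=> j _; rewrite !mxE; field; rewrite gt_eqF.
  rewrite prodr_const card_ord; apply.
  + by move=> j; rewrite !mxE divr_ge0.
  + by move=> j; rewrite !mxE ler_pM2r ?invr_gt0//; lra.
  + move=> j; rewrite !mxE ltr_pdivrMr// mul1r.
    have : (k j).+1%:R <= M%:R :> R by rewrite ler_nat.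
    by rewrite -natr1; lra.
  by move=> x xk; rewrite inE r2 box_label_grid.
- by rewrite exprn_ge0// divr_ge0.
have rq' : (r - 2 < q)%N by rewrite ltn_subLR//; rewrite leqNgt.
have := @cell_pmf_box_ge Q (fun l => l \in role_labels q k r) (lo (Ordinal rq')) (hi (Ordinal rq')).
rewrite (eq_bigr (fun=> rho / 2)); last by move=> j _; case: (lohi (Ordinal rq') j).
rewrite prodr_const card_ord; apply.
- by move=> j; case: (lohi (Ordinal rq') j).
- by move=> j; case: (lohi (Ordinal rq') j) => _ _ e; rewrite -subr_ge0 e divr_ge0.
- by move=> j; case: (lohi (Ordinal rq') j).
move=> x xr; rewrite inE (negbTE r2); case: insubP => //= j _ jr.
by rewrite ffunE (_ : j = Ordinal rq')//; apply: val_inj.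
Qed.

End cell_label_law.

(** * The tail bound *)

(** Rounding changes the logarithm in base 2 by at most 1/2, so the number of
    cells is [n / lambda0] up to a factor [sqrt 2 <= 2]. *)
Lemma partition_level_bounds (R : realType) (lambda0 : R) n :
  0 < lambda0 -> lambda0 <= n%:R ->
  n%:R / (2 * lambda0) <= (2 ^ partition_level lambda0 n)%N%:R <= 2 / lambda0 * n%:R.
Proof.
move=> l0 ln0.
have n0 : (0 : R) < n%:R by apply: lt_le_trans ln0.
have ratio0 : 0 < n%:R / lambda0 by rewrite divr_gt0.
have l2 : 0 < ln 2 :> R by rewrite ln_gt0// ltr1n.
rewrite /partition_level /round; set y := ln _ / _.
have y0 : 0 <= y.
  apply: divr_ge0; last exact: ltW.
  by apply: ln_ge0; rewrite ler_pdivlMr// mul1r.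
have ny : n%:R / lambda0 = expR (y * ln 2) by rewrite divfK ?gt_eqF// lnK.
have fl0 : (0 <= Num.floor (y + 2^-1))%R by rewrite floor_ge0; lra.
have Er : (absz (Num.max 0 (Num.floor (y + 2^-1))))%:R = (Num.floor (y + 2^-1))%:~R :> R.
  by rewrite max_r// natr_absz ger0_norm.
set r := absz _ in Er *.
have /andP[r1 r2] : y - 2^-1 <= r%:R <= y + 2^-1.
  rewrite Er floor_le andbT.
  have := lt_succ_floor (y + 2^-1); rewrite intrD; lra.
have Jr : (2 ^ r)%N%:R = expR (r%:R * ln 2) :> R.
  by rewrite expRM_natl lnK ?posrE// natrX.
have half : expR (2^-1 * ln 2) <= 2 :> R.
  have e2 : expR (ln 2) = 2 :> R by rewrite lnK// posrE.
  apply: (@le_trans _ _ (expR (ln 2))); last by rewrite e2.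
  by rewrite ler_expR ler_piMl ?ltW// invf_lt1// ltr1n.
rewrite Jr; apply/andP; split.
  rewrite (_ : _ / _ = n%:R / lambda0 / 2); last by field; rewrite gt_eqF.
  rewrite ler_pdivrMr// ny.
  apply: (@le_trans _ _ (expR (r%:R * ln 2) * expR (2^-1 * ln 2))); last first.
    by rewrite ler_wpM2l ?expR_ge0.
  by rewrite -expRD ler_expR -mulrDl ler_wpM2r ?(ltW l2)// -lerBlDr.
rewrite (_ : 2 / lambda0 * n%:R = n%:R / lambda0 * 2); last by field; rewrite gt_eqF.
rewrite ny.
apply: (@le_trans _ _ (expR (y * ln 2) * expR (2^-1 * ln 2))).
  by rewrite -expRD ler_expR -mulrDl ler_wpM2r// ltW.
by rewrite ler_wpM2l ?expR_ge0.
Qed.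

Lemma sum_ffun_pair (R : nmodType) (I T L : finType) (F : {ffun I -> T * L} -> R) :
  \sum_v F v = \sum_(a : {ffun I -> T}) \sum_(l : {ffun I -> L})
    F [ffun i => (a i, l i)].
Proof.
rewrite pair_big/= (reindex (fun al : {ffun I -> T} * {ffun I -> L} =>
  [ffun i => (al.1 i, al.2 i)]))//=.
exists (fun v => ([ffun i => (v i).1], [ffun i => (v i).2])) => [[a l] _|v _] /=.
  by congr pair; apply/ffunP => i; rewrite !ffunE.
by apply/ffunP => i; rewrite !ffunE; case: (v i).
Qed.

Section good_cells_tail.
Context (R : realType) (d q : nat) (psi : 'I_q -> mpoly d R).
Context (u : 'I_q -> 'rV[R]_d) (rho lam B : R).
Hypotheses (q_gt0 : (0 < q)%N) (lam_gt0 : 0 < lam) (B_gt0 : 0 < B).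
Hypotheses (rho_gt0 : 0 < rho) (rho_le1 : rho <= 1) (cube_u : forall r, cube (u r)).
Hypothesis lam_le : forall x : 'I_q -> 'rV[R]_d,
  (forall r j, `|x r 0 j - u r 0 j| <= rho) ->
  forall c : 'cV[R]_q, lam * (\sum_k c k 0 ^+ 2) <= \sum_r poly_vec psi c (x r) ^+ 2.
Hypothesis B_ge : forall x, cube x -> forall c : 'cV[R]_q,
  poly_vec psi c x ^+ 2 <= B * (\sum_k c k 0 ^+ 2).

Context (pl pu lambda0 : R).
Hypotheses (pl_gt0 : 0 < pl) (pu_gt0 : 0 < pu) (lambda0_gt0 : 0 < lambda0).

(** The expected number of cells with [q + 2] points is at least this constant
    times [n]: it is the lower bound of [binomial_pmf_ge] times the proportion
    [1 / (2 * lambda0)] of cells per observation. *)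
Definition occupancy_const : R :=
  (pl * 2^-1 ^+ d * lambda0 / 2 / 2) ^+ q.+2 / (q.+2)`!%:R
    * expR (- (2 * (2 * pu * lambda0))) / (2 * lambda0).

Lemma occupancy_const_gt0 : 0 < occupancy_const.
Proof.
apply: divr_gt0; last by rewrite mulr_gt0.
apply: mulr_gt0; last exact: expR_gt0.
apply: divr_gt0; last by rewrite ltr0n fact_gt0.
by rewrite exprn_gt0// !divr_gt0// !mulr_gt0// exprn_gt0// invr_gt0.
Qed.

(** The bound on [delta] is the number of grid boxes times the probability
    that two points fall in the same given box and [q] points fall in the
    successive node boxes. *)
Lemma good_cells_tail (theta : model_param R d) (s : 'I_d -> nat) (M n : nat)
    (h delta x : R) (disp : measure_display) (Omega : measurableType disp)
    (P : probability Omega R) (Z : 'I_n -> {RV P >-> ('rV[R]_d * R)%type}) :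
  (forall x, cube x -> pl <= dens theta x <= pu) -> iid_sample theta Z ->
  n%:R / (2 * lambda0) <= (2 ^ \sum_j s j)%N%:R <= 2 / lambda0 * n%:R ->
  (2 * q.+2 <= n)%N -> 2 * (2 * pu * lambda0) <= n%:R ->
  (0 < M)%N -> M%:R^-1 <= h ->
  0 <= delta <= 3^-1 ->
  delta <= M%:R ^+ d * ((pl / pu * (2 * M%:R)^-1 ^+ d) ^+ 2 *
    (pl / pu * (rho / 2) ^+ d) ^+ q) ->
  (P [set w | (#|good_cells psi s (fun i => (Z i w).1) (lam / q.+2%:R)
        (Num.min 4^-1 (lam / (4 * B))) h|%:R < x)%R] <=
   (expR (x - delta / 2 * (occupancy_const * n%:R) + n%:R * delta ^+ 2))%:E)%E.
Proof.
move=> dens_bounds iid /andP[J1 J2] mn bn M0 Mh d3 dK.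
have n0 : (0 < n)%N by apply: leq_trans mn.
have nR : (0 : R) < n%:R by rewrite ltr0n.
have J0 : (0 : R) < (2 ^ \sum_j s j)%N%:R by rewrite ltr0n expn_gt0.
pose lo := node_lo u rho; pose hi := node_hi u rho.
have lohi := node_box_bounds rho_gt0 rho_le1 cube_u.
pose lab := cell_label s M lo hi.
have mlab : fin_measurable lab by exact: cell_label_measurable.
pose pmf c l := label_pmf theta lab (c, l).
pose T := (option (cell s) * (option {ffun 'I_d -> 'I_M} * {ffun 'I_q -> bool}))%type.
pose E (v : {ffun 'I_n -> T}) : bool :=
  #|hit_cells q.+2 (@role_labels d q M) [ffun i => (v i).1] [ffun i => (v i).2]|%:R < x.
have mA : measurable [set w | (#|good_cells psi s (fun i => (Z i w).1) (lam / q.+2%:R)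
        (Num.min 4^-1 (lam / (4 * B))) h|%:R < x)%R].
  pose f w := good_cells psi s (fun i => (Z i w).1) (lam / q.+2%:R)
        (Num.min 4^-1 (lam / (4 * B))) h.
  apply: (@fin_measurable_pred _ _ {set cell s} f (fun G => #|G|%:R < x)).
  apply: fin_measurable_set => Q.
  apply: (@good_cell_measurable R d q psi s n Q _ _ _ q_gt0 _ Omega (fun w i => (Z i w).1)).
  move=> i j; apply: (measurableT_comp (measurable_row_coord j)).
  exact: (measurableT_comp measurable_fst).
apply: le_trans (sample_prob_le mlab iid mA (E := E) _) _.
  move=> w /=; rewrite /E; apply: le_lt_trans; rewrite ler_nat subset_leq_card//.
  rewrite [X in hit_cells _ _ X](_ : _ = [ffun i => (lab (Z i w).1).1]); last first.
    by apply/ffunP => i; rewrite !ffunE.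
  rewrite [X in hit_cells _ _ _ X](_ : _ = [ffun i => (lab (Z i w).1).2]); last first.
    by apply/ffunP => i; rewrite !ffunE.
  exact: (@hit_cells_good R d q psi u rho lam B q_gt0 lam_gt0 B_gt0 rho_gt0
    cube_u lam_le B_ge s M n M0 (fun i => (Z i w).1) h Mh).
rewrite lee_fin sum_ffun_pair.
pose theta_ r : R := if (r < 2)%N then pl / pu * (2 * M%:R)^-1 ^+ d
  else pl / pu * (rho / 2) ^+ d.
have theta_ge0 r : 0 <= theta_ r.
  have plpu : 0 <= pl / pu by rewrite divr_ge0// ltW.
  by rewrite /theta_; case: ifP => _; rewrite mulr_ge0// exprn_ge0// divr_ge0// ltW.
have pmf1 : \sum_c \sum_l pmf c l = 1.
  rewrite pair_big/= -(sum_label_pmfT mlab iid n0).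
  by apply: eq_bigr => -[].
have deltaK : delta <= #|{: {ffun 'I_d -> 'I_M}}|%:R * \prod_(r < q.+2) theta_ r.
  rewrite card_ffun !card_ord natrX.
  rewrite (_ : \prod_(r < _) _ = theta_ 0 ^+ 2 * theta_ 2 ^+ q)//.
  by rewrite !big_ord_recl/= mulrA -expr2 prodr_const card_ord.
have pmf_role Q k r : (r < q.+2)%N ->
    theta_ r * \sum_l pmf (Some Q) l <= \sum_(l in @role_labels d q M k r) pmf (Some Q) l.
  exact: (@role_pmf_ge R d q theta pl pu pl_gt0 pu_gt0 dens_bounds s M lo hi rho
    M0 (ltW rho_gt0) lohi disp Omega P n Z iid n0 Q k r).
have mean : occupancy_const * n%:R <= \sum_Q (\sum_l pmf (Some Q) l) ^+ q.+2 *
    (1 - \sum_l pmf (Some Q) l) ^+ (n - q.+2) *+ 'C(n, q.+2).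
  pose c0 : R := (pl * 2^-1 ^+ d * lambda0 / 2 / 2) ^+ q.+2 / (q.+2)`!%:R
    * expR (- (2 * (2 * pu * lambda0))).
  have c00 : 0 <= c0.
    have inv0 : 0 < (2 * lambda0)^-1 by rewrite invr_gt0 mulr_gt0.
    by apply: ltW; rewrite -(pmulr_lgt0 _ inv0); exact: occupancy_const_gt0.
  apply: (@le_trans _ _ (\sum_(Q : cell s) c0)).
    rewrite sumr_const -/(#|{: cell s}|) card_cell -[leRHS]mulr_natr /occupancy_const -/c0.
    by rewrite -mulrA ler_wpM2l// mulrC.
  apply: ler_sum => Q _; apply: binomial_pmf_ge => //.
  - by rewrite !divr_ge0// !mulr_ge0 ?exprn_ge0 ?invr_ge0// ltW.
  - apply: le_trans (cell_pmf_ge pl_gt0 dens_bounds M lo hi iid n0 Q).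
    rewrite ler_pdivlMr// mulrAC ler_pdivrMr//.
    apply: (@le_trans _ _ (pl * 2^-1 ^+ d * lambda0 / 2 * (2 / lambda0 * n%:R))).
      by rewrite ler_wpM2l// !divr_ge0// !mulr_ge0 ?exprn_ge0 ?invr_ge0// ltW.
    by rewrite le_eqVlt; apply/orP; left; apply/eqP; field; rewrite gt_eqF.
  apply: le_trans (cell_pmf_le pl_gt0 pu_gt0 dens_bounds M lo hi iid n0 Q) _.
  rewrite ler_pdivrMr// mulrAC ler_pdivlMr//.
  apply: (@le_trans _ _ (2 * pu * lambda0 * (n%:R / (2 * lambda0)))).
    by rewrite le_eqVlt; apply/orP; left; apply/eqP; field; rewrite gt_eqF.
  by rewrite ler_wpM2l// !mulr_ge0// ltW.
apply: le_trans (occupancy_tail x (@role_disjoint d q M)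
  (fun c l => label_pmf_ge0 mlab iid (c, l) n0) pmf1 theta_ge0 pmf_role
  (ltn0Sn _) d3 deltaK mean).
apply: ler_sum => a _; apply: ler_sum => l _.
rewrite (_ : \prod_i label_pmf _ _ _ = \prod_i pmf (a i) (l i)); last first.
  by apply: eq_bigr => i _; rewrite ffunE.
rewrite /E (_ : [ffun i => _] = a); last by apply/ffunP => i; rewrite !ffunE.
by rewrite (_ : [ffun i => _] = l)//; apply/ffunP => i; rewrite !ffunE.
Qed.

End good_cells_tail.

Theorem lemma3p6 (R : realType) (d : nat) (beta_b beta_g : R)
    (U : set 'rV[R]_d) (pl pu L vl vu M4 lambda0 : R)
    (psi : 'I_'C(d + holder_order beta_b, holder_order beta_b) -> mpoly d R)
    (beta_b_gt1 : 1 < beta_b) (beta_g_gt0 : 0 < beta_g)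
    (d_gt : 4 * beta_b < d%:R)
    (openU : open U) (cubeU : @cube R d `<=` U)
    (pl_gt0 : 0 < pl) (pl_lt1 : pl < 1) (pu_gt1 : 1 < pu) (L_ge1 : 1 <= L)
    (vl_gt0 : 0 < vl) (vl_le_vu : vl <= vu) (M4_gt : vu ^+ 2 < M4)
    (lambda0_gt0 : 0 < lambda0)
    (psi_basis : poly_basis (holder_order beta_b) psi) :
  exists kappa v0 : R, [/\ 0 < kappa, 0 < v0 &
    forall t : nat -> R, (forall n, 0 < t n) ->
      t @ \oo --> (0 : R) ->
      (fun n => n%:R * t n ^+ d) @ \oo --> +oo ->
    exists c C : R, [/\ 0 < c, 0 < C &
      \forall n \near \oo,
        forall (s : 'I_d -> nat), level_split (partition_level lambda0 n) s ->
        forall theta : model_param R d,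
          Theta pl pu L vl vu M4 U beta_b beta_g theta ->
        forall (disp : measure_display) (Omega : measurableType disp)
          (P : probability Omega R)
          (Z : 'I_n -> {RV P >-> ('rV[R]_d * R)%type}),
          iid_sample theta Z ->
        (P [set w | (#|good_cells psi s (fun i => (Z i w).1) kappa v0 (t n)|%:R
                       < c * (n%:R * t n ^+ d))%R]
           <= (C * expR (- (c * (n%:R * t n ^+ d))))%:E)%E]].

Proof.
set l := holder_order beta_b in psi psi_basis *; set q := 'C(d + l, l) in psi psi_basis *.
have q_gt0 : (0 < q)%N by rewrite bin_gt0 leq_addl.
have d_gt0 : (0 < d)%N.
  by rewrite -(ltr0n R); apply: le_lt_trans d_gt; rewrite mulr_ge0//; lra.
have psi_free := poly_basis_free psi_basis.
have [B B_gt0 B_ge] := poly_vec_bound psi.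
have [u [rho [lam [/andP[rho_gt0 rho_le1] lam_gt0 cube_u lam_le]]]] :=
  unisolvent_boxes psi_free.
have pu_gt0 : 0 < pu by lra.
exists (lam / q.+2%:R), (Num.min 4^-1 (lam / (4 * B))); split.
- by rewrite divr_gt0.
- by rewrite lt_min invr_gt0 divr_gt0 ?mulr_gt0//; lra.
move=> t t_gt0 t_cvg _.
(* beta bounds below the conditional probability of a node box, and c2 * T is
   an admissible delta because 1 / M is at least t / 2. *)
pose beta := pl / pu * (rho / 2) ^+ d.
pose c1 := occupancy_const d q pl pu lambda0.
pose c2 := (pl / pu) ^+ 2 * beta ^+ q * 8^-1 ^+ d.
have c1_gt0 : 0 < c1 by exact: occupancy_const_gt0.
have c2_gt0 : 0 < c2.
  by rewrite !mulr_gt0 ?exprn_gt0 ?invr_gt0 ?mulr_gt0 ?exprn_gt0 ?divr_gt0 ?invr_gt0.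
exists (c1 * c2 / 8), 1; split; [by rewrite divr_gt0// (mulr_gt0 c1_gt0 c2_gt0)|by []|].
(* The last threshold makes n * delta ^ 2 at most a quarter of the main term. *)
pose tau := Num.min 1 (Num.min (3^-1 / c2) (c1 / 8 / c2)).
have tau_gt0 : 0 < tau.
  rewrite !lt_min ltr01 (divr_gt0 _ c2_gt0) ?invr_gt0//=.
  by apply: divr_gt0 c2_gt0; exact: divr_gt0.
pose N0 := Num.max lambda0 (Num.max (2 * q.+2)%N%:R (2 * (2 * pu * lambda0))).
have t_small : \forall n \near \oo, t n <= tau.
  have /cvgrPdist_le/(_ _ tau_gt0) := t_cvg; apply: filterS => n.
  by rewrite sub0r normrN ger0_norm ?(ltW (t_gt0 n)).
have n_large : \forall n \near \oo, N0 <= n%:R by exact: nbhs_infty_ger.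
near=> n.
have tn0 := t_gt0 n.
have : t n <= tau by near: n.
rewrite !le_min => /andP[t1 /andP[t2 t3]].
have : N0 <= n%:R by near: n.
rewrite !ge_max => /andP[n1 /andP[n2 n3]].
move=> s [s_sum _] theta [_ [_ dens_bounds] _ _ _] disp Omega P Z iid.
pose T := t n ^+ d; have T_gt0 : 0 < T by rewrite exprn_gt0.
have Tt : T <= t n by rewrite -[leRHS]expr1 ler_wiXn2l// ltW.
pose M := (Num.truncn (t n)^-1).+1.
have M_gt0 : (0 : R) < M%:R by rewrite ltr0n.
have tM : (t n)^-1 <= M%:R by rewrite ltW// truncnS_gt.
have Mt : M%:R <= 2 / t n.
  have h : (Num.truncn (t n)^-1)%:R <= (t n)^-1 by rewrite truncn_le// invr_ge0 ltW.
  have h1 : 1 <= (t n)^-1 by rewrite invf_ge1.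
  rewrite (_ : M%:R = (Num.truncn (t n)^-1)%:R + 1); last by rewrite natr1.
  by apply: (@le_trans _ _ ((t n)^-1 + (t n)^-1)); [exact: lerD|lra].
have tail := @good_cells_tail R d q psi u rho lam B q_gt0 lam_gt0 B_gt0 rho_gt0 rho_le1
  cube_u lam_le B_ge pl pu lambda0 pl_gt0 pu_gt0 lambda0_gt0 theta s M n (t n) (c2 * T)
  (c1 * c2 / 8 * (n%:R * T)) disp Omega P Z dens_bounds iid.
apply: le_trans (tail _ _ _ _ _ _ _) _ => //.
- by rewrite s_sum; exact: partition_level_bounds.
- by rewrite -(ler_nat R).
- by rewrite -[t n]invrK lef_pV2 ?posrE// invr_gt0.
- rewrite (ltW (mulr_gt0 c2_gt0 T_gt0))/= mulrC -ler_pdivlMr//; exact: le_trans Tt t2.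
- have -> : M%:R ^+ d * ((pl / pu * (2 * M%:R)^-1 ^+ d) ^+ 2 * beta ^+ q) =
      (pl / pu) ^+ 2 * beta ^+ q * (4 * M%:R)^-1 ^+ d.
    rewrite !exprMn (_ : (4 * M%:R)^-1 = (2 * M%:R)^-1 * (2 * M%:R)^-1 * M%:R); last first.
      by field; rewrite gt_eqF.
    by rewrite !exprMn expr2; ring.
  have plpu : 0 < pl / pu by rewrite divr_gt0.
  have beta_gt0 : 0 < beta by rewrite (mulr_gt0 plpu)// exprn_gt0// divr_gt0.
  rewrite /c2 -mulrA ler_wpM2l ?(ltW (mulr_gt0 (exprn_gt0 _ plpu) (exprn_gt0 _ beta_gt0)))//.
  rewrite -exprMn; apply: lerXn2r; rewrite ?nnegrE.
  + by rewrite mulr_ge0// ltW.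
  + by rewrite invr_ge0 mulr_ge0.
  rewrite -[leLHS]invrK lef_pV2 ?posrE ?invr_gt0 ?mulr_gt0//.
  rewrite invfM invrK; apply: (@le_trans _ _ (4 * (2 / t n))); first by rewrite ler_wpM2l.
  by rewrite mulrA le_eqVlt; apply/orP; left; apply/eqP; ring.
rewrite lee_fin mul1r ler_expR.
have dT : c2 * T <= c1 / 8.
  by rewrite mulrC -ler_pdivlMr//; exact: le_trans Tt t3.
have n0 : (0 : R) <= n%:R by [].
have sq : n%:R * (c2 * T) ^+ 2 <= n%:R * (c2 * T * (c1 / 8)).
  by rewrite ler_wpM2l// expr2 ler_wpM2l// (ltW (mulr_gt0 c2_gt0 T_gt0)).
have K0 : 0 <= n%:R * (c1 * (c2 * T)).
  by rewrite mulr_ge0// (ltW (mulr_gt0 c1_gt0 (mulr_gt0 c2_gt0 T_gt0))).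
rewrite (_ : c1 * c2 / 8 * (n%:R * T) = n%:R * (c1 * (c2 * T)) / 8); last by field.
rewrite (_ : c2 * T / 2 * (c1 * n%:R) = n%:R * (c1 * (c2 * T)) / 2); last by field.
move: sq K0.
rewrite (_ : n%:R * (c2 * T * (c1 / 8)) = n%:R * (c1 * (c2 * T)) / 8); last by field.
lra.
Unshelve. all: by end_near. Qed.
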